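(* Let $\Lambda$ be a row-finite $k$-graph with no sources and let $K$ be a field. (1) Let $v\in\Lambda^0$. Then $\mathrm{KP}_K(\Lambda)p_v$ is a minimal left-ideal of $\mathrm{KP}_K(\Lambda)$ if and only if $v$ is a line point, i.e. $v\in P_l(\Lambda)$. (2) Let $a\in \mathrm{KP}_K(\Lambda)$. Then $\mathrm{KP}_K(\Lambda)a$ is a minimal left-ideal of $\mathrm{KP}_K(\Lambda)$ if and only if there exists $v\in P_l(\Lambda)$ such that $\mathrm{KP}_K(\Lambda)p_v$ is isomorphic to $\mathrm{KP}_K(\Lambda)a$ as left $\mathrm{KP}_K(\Lambda)$-modules.
   Context: $\mathbb N=\{0,1,2,\dots\}$; $k$ is a positive integer; $\mathbb N^k$ is ordered coordinatewise. A $k$-graph is a countable category $\Lambda$ with object set $\Lambda^0$ and range and source maps $r,s$, with a functor $d:\Lambda\to\mathbb N^k$ ($\mathbb N^k$ viewed as a one-object category) such that whenever $d(\lambda)=m+n$ there are unique $\mu,\nu\in\Lambda$ with $s(\mu)=r(\nu)$, $d(\mu)=m$, $d(\nu)=n$, $\lambda=\mu\nu$. Morphisms are called paths; objects (vertices) are identified with the paths of degree $0$. $\Lambda^n=d^{-1}(n)$, $\Lambda^{\neq 0}=\Lambda\setminus\Lambda^0$, $v\Lambda=\{\lambda: r(\lambda)=v\}$, $v\Lambda^n=v\Lambda\cap\Lambda^n$. $\Lambda$ is row-finite with no sources if $0<|v\Lambda^n|<\infty$ for all $v\in\Lambda^0$, $n\in\mathbb N^k$. Infinite paths: $\Omega_k$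 is the $k$-graph with objects $\mathbb N^k$, morphisms $(m,n)$ with $m\le n$, $r(m,n)=m$, $s(m,n)=n$, $(m,n)(n,p)=(m,p)$, $d(m,n)=n-m$. $\Lambda^\infty$ is the set of degree-preserving functors $x:\Omega_k\to\Lambda$; $x(m):=x(m,m)$; $v\Lambda^\infty=\{x\in\Lambda^\infty:x(0)=v\}$. For $p\in\mathbb N^k$, $\sigma^p(x)(m,n)=x(m+p,n+p)$. $x$ is periodic if $\sigma^p(x)=\sigma^q(x)$ for some $p\ne q$ in $\mathbb N^k$, and aperiodic otherwise. A vertex $v$ is a line point if $v\Lambda^\infty=\{x\}$ is a singleton and $x$ is aperiodic; $P_l(\Lambda)$ is the set of line points. Kumjian-Pask algebra: $\mathrm{KP}_K(\Lambda)$ is the universal $K$-algebra generated by elements $p_v$ ($v\in\Lambda^0$), $s_\lambda$, $s_{\lambda^*}$ ($\lambda\in\Lambda^{\ne0}$) subject to: (KP1) the $p_v$ are mutually orthogonal idempotents; (KP2) for $\lambda,\mu\in\Lambda^{\neq0}$ with $r(\mu)=s(\lambda)$: $s_\lambda s_\mu=s_{\lambda\mu}$, $s_{\mu^*}s_{\lambda^*}=s_{(\lambda\mu)^*}$, $p_{r(\lambda)}s_\lambda=s_\lambda=s_\lambda p_{s(\lambda)}$, $p_{s(\lambda)}s_{\lambda^*}=s_{\lambda^*}=s_{\lambda^*}p_{r(\lambda)}$; (KP3) $s_{\lambda^*}s_\mu=\delta_{\lambda,\mu}p_{s(\lambda)}$ if $d(\lambda)=d(\mu)$; (KP4) $p_v=\sum_{\lambda\in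 v\Lambda^n}s_\lambda s_{\lambda^*}$ for all $v\in\Lambda^0$, $n\in\mathbb N^k\setminus\{0\}$. (The algebra need not be unital.) A minimal left-ideal is a nonzero left ideal containing no left ideals other than $\{0\}$ and itself. *)

(* Defs.v *)
From HB Require Import structures.
From mathcomp Require Import all_boot all_order all_algebra.
From mathcomp Require Import all_classical.

Set Implicit Arguments.
Unset Strict Implicit.
Unset Printing Implicit Defensive.

Import GRing.Theory.
Local Open Scope classical_set_scope.
Local Open Scope ring_scope.
Local Open Scope quotient_scope.

Definition Nk (k : nat) := {ffun 'I_k -> nat}.
HB.instance Definition _ k := GRing.Nmodule.on (Nk k).
HB.instance Definition _ k := Countable.on (Nk k).

Definition leNk k (m n : Nk k) : bool := [forall i, (m i <= n i)%N].
Definition subNk k (n m : Nk k) : Nk k := [ffun i => (n i - m i)%N].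

(* A small category with countably many objects and morphisms and a degree
   functor with unique factorisation.  [kcomp l m] is the composite "l m", which
   is meaningful only when [src l = rng m]; all the axioms are restricted to
   that case, and the value of [kcomp] elsewhere is irrelevant. *)
Record kgraph (k : nat) := KGraph {
  vertex : countType;
  kpath :> countType;
  rng : kpath -> vertex;
  src : kpath -> vertex;
  idp : vertex -> kpath;
  kcomp : kpath -> kpath -> kpath;
  deg : kpath -> Nk k;
  rng_idp : forall v, rng (idp v) = v;
  src_idp : forall v, src (idp v) = v;
  rng_comp : forall l m, src l = rng m -> rng (kcomp l m) = rng l;
  src_comp : forall l m, src l = rng m -> src (kcomp l m) = src m;
  kcomp_idl : forall l, kcomp (idp (rng l)) l = l;
  kcomp_idr : forall l, kcomp l (idp (src l)) = l;
  kcompA : forall l m n, src l = rng m -> src m = rng n ->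
    kcomp l (kcomp m n) = kcomp (kcomp l m) n;
  deg_idp : forall v, deg (idp v) = 0;
  deg_comp : forall l m, src l = rng m -> deg (kcomp l m) = deg l + deg m;
  factorisation : forall (l : kpath) (m n : Nk k), deg l = m + n ->
    exists! p : kpath * kpath,
      [/\ src p.1 = rng p.2, deg p.1 = m, deg p.2 = n & l = kcomp p.1 p.2]
}.
Arguments vertex {k}.
Arguments rng {k L} : rename.
Arguments src {k L} : rename.
Arguments idp {k L} : rename.
Arguments kcomp {k L} : rename.
Arguments deg {k L} : rename.

Definition paths_from k (L : kgraph k) (v : vertex L) (n : Nk k) : set L :=
  [set l : L | rng l = v /\ deg l = n].

Definition row_finite_no_sources k (L : kgraph k) : Prop :=
  forall (v : vertex L) (n : Nk k),
    paths_from v n !=set0 /\ finite_set (paths_from v n).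

Section Omega.
Variable k : nat.
Implicit Types m n p : Nk k.

Lemma leNk_refl m : leNk m m.
Proof. exact/forallP. Qed.

Lemma leNk_trans n m p : leNk m n -> leNk n p -> leNk m p.
Proof.
move=> /forallP mn /forallP np; apply/forallP => i; exact: leq_trans (mn i) (np i).
Qed.

Lemma leNk_add2r p m n : leNk m n -> leNk (m + p) (n + p).
Proof.
by move=> /forallP mn; apply/forallP => i; rewrite !ffunE leq_add2r.
Qed.

Definition Omega_path := {mn : Nk k * Nk k | leNk mn.1 mn.2}.
HB.instance Definition _ := Countable.on Omega_path.

Definition Omega_arrow m n (mn : leNk m n) : Omega_path := exist _ (m, n) mn.
Definition Omega_rng (f : Omega_path) := (val f).1.
Definition Omega_src (f : Omega_path) := (val f).2.
Definition Omega_id m := Omega_arrow (leNk_refl m).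
Definition Omega_comp (f g : Omega_path) : Omega_path :=
  insubd f (Omega_rng f, Omega_src g).
Definition Omega_deg (f : Omega_path) := subNk (Omega_src f) (Omega_rng f).

Lemma val_Omega_comp f g : Omega_src f = Omega_rng g ->
  val (Omega_comp f g) = (Omega_rng f, Omega_src g).
Proof.
rewrite /Omega_src /Omega_rng => fg; rewrite val_insubd /=.
by rewrite (@leNk_trans (val f).2) ?(valP f)// fg (valP g).
Qed.

Lemma Omega_rng_comp f g : Omega_src f = Omega_rng g ->
  Omega_rng (Omega_comp f g) = Omega_rng f.
Proof. by move=> /val_Omega_comp fg; rewrite /Omega_rng fg. Qed.

Lemma Omega_src_comp f g : Omega_src f = Omega_rng g ->
  Omega_src (Omega_comp f g) = Omega_src g.
Proof. by move=> /val_Omega_comp fg; rewrite /Omega_src fg. Qed.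

Lemma Omega_comp_idl f : Omega_comp (Omega_id (Omega_rng f)) f = f.
Proof. by apply: val_inj; rewrite val_Omega_comp// /Omega_rng /Omega_src /=; case: (val f). Qed.

Lemma Omega_comp_idr f : Omega_comp f (Omega_id (Omega_src f)) = f.
Proof. by apply: val_inj; rewrite val_Omega_comp// /Omega_rng /Omega_src /=; case: (val f). Qed.

Lemma Omega_compA f g h :
    Omega_src f = Omega_rng g -> Omega_src g = Omega_rng h ->
  Omega_comp f (Omega_comp g h) = Omega_comp (Omega_comp f g) h.
Proof.
move=> fg gh; apply: val_inj.
rewrite !val_Omega_comp ?Omega_rng_comp ?Omega_src_comp//.
Qed.

Lemma Omega_deg_id m : Omega_deg (Omega_id m) = 0.
Proof. by apply/ffunP => i; rewrite !ffunE subnn. Qed.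

Lemma Omega_deg_comp f g : Omega_src f = Omega_rng g ->
  Omega_deg (Omega_comp f g) = Omega_deg f + Omega_deg g.
Proof.
move=> fg; rewrite /Omega_deg Omega_rng_comp ?Omega_src_comp//.
have /forallP Hf := valP f; have /forallP Hg := valP g.
apply/ffunP => i; rewrite !ffunE fg; move: (Hf i) (Hg i).
rewrite -/(Omega_rng f) -/(Omega_src f) -/(Omega_rng g) -/(Omega_src g) fg.
move=> fi gi; rewrite -[RHS]/(addn _ _).
by rewrite addnC addnBA// subnK.
Qed.

Lemma Omega_factorisation f m n : Omega_deg f = m + n ->
  exists! p : Omega_path * Omega_path,
    [/\ Omega_src p.1 = Omega_rng p.2, Omega_deg p.1 = m, Omega_deg p.2 = n
      & f = Omega_comp p.1 p.2].
Proof.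
move=> fmn; have /forallP Hf := valP f.
have fE i : (m i + n i = (val f).2 i - (val f).1 i)%N.
  by have /ffunP/(_ i) := fmn; rewrite !ffunE => ->.
have rm : leNk (Omega_rng f) (Omega_rng f + m).
  by apply/forallP => i; rewrite !ffunE; exact: leq_addr.
have ms : leNk (Omega_rng f + m) (Omega_src f).
  apply/forallP => i; rewrite !ffunE -[X in (X <= _)%N]/(addn _ _).
  by rewrite -leq_subRL ?Hf// -fE leq_addr.
exists (Omega_arrow rm, Omega_arrow ms); split.
  split => //=.
  - apply/ffunP => i; rewrite !ffunE; exact: addKn.
  - apply/ffunP => i; rewrite !ffunE -[X in (_ - X)%N]/(addn _ _).
    by rewrite subnDA -fE addKn.
  - by apply: val_inj; rewrite val_Omega_comp// /Omega_rng /Omega_src /=; case: (val f).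
move=> [g h] /= [gh gm hn fgh].
have := val_Omega_comp gh; rewrite -fgh => fE'.
have gE : (val g).1 = Omega_rng f by rewrite /Omega_rng fE'.
have hE : (val h).2 = Omega_src f by rewrite /Omega_src fE'.
have gE2 : (val g).2 = Omega_rng f + m.
  apply/ffunP => i; rewrite -gE -gm !ffunE; apply/esym/subnKC.
  by have /forallP := valP g.
have vE (e : Omega_path) (c d : Nk k) : (val e).1 = c -> (val e).2 = d ->
  (c, d) = val e by move=> <- <-; case: (val e).
congr pair; apply: val_inj; apply: vE => //; by rewrite -gE2.
Qed.

Definition Omega : kgraph k :=
  @KGraph k (Nk k) Omega_path Omega_rng Omega_src Omega_id Omega_comp Omega_deg
    (fun=> erefl) (fun=> erefl) Omega_rng_comp Omega_src_comp Omega_comp_idl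
    Omega_comp_idr Omega_compA Omega_deg_id Omega_deg_comp Omega_factorisation.

End Omega.

(* The morphism part of a degree-preserving functor; the object part [x0] is
   determined by [x], as [idp] is injective. *)
Definition kfunctor k (L M : kgraph k) (x : L -> M) : Prop :=
  exists x0 : vertex L -> vertex M,
    [/\ forall v, x (idp v) = idp (x0 v),
        forall f, rng (x f) = x0 (rng f) /\ src (x f) = x0 (src f),
        forall f g, src f = rng g -> x (kcomp f g) = kcomp (x f) (x g)
      & forall f, deg (x f) = deg f].

Definition infinite_paths k (L : kgraph k) : set (Omega k -> L) :=
  [set x | kfunctor x].
Arguments infinite_paths {k} L.

Definition infinite_paths_from k (L : kgraph k) (v : vertex L) :
    set (Omega k -> L) :=
  [set x | infinite_paths L x /\ x (Omega_id 0) = idp v].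

Definition Omega_translate k (p : Nk k) (f : Omega k) : Omega k :=
  Omega_arrow (leNk_add2r p (valP f)).

Definition shift k (L : kgraph k) (p : Nk k) (x : Omega k -> L) : Omega k -> L :=
  fun f => x (Omega_translate p f).

Definition periodic k (L : kgraph k) (x : Omega k -> L) : Prop :=
  exists p q : Nk k, p <> q /\ shift p x = shift q x.

Definition aperiodic k (L : kgraph k) (x : Omega k -> L) : Prop := ~ periodic x.

Definition line_points k (L : kgraph k) : set (vertex L) :=
  [set v | exists x : Omega k -> L,
     infinite_paths_from v = [set x] /\ aperiodic x].
Arguments line_points {k} L.

HB.mixin Record Lmodule_isNUAlgebra (K : fieldType) A of GRing.Lmodule K A := {
  numul : A -> A -> A;
  numulA : associative numul;
  numulDl : left_distributive numul +%R;
  numulDr : right_distributive numul +%R;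
  nuscaleAl : forall (c : K) (a b : A), c *: numul a b = numul (c *: a) b;
  nuscaleAr : forall (c : K) (a b : A), c *: numul a b = numul a (c *: b)
}.

#[short(type="nualgType")]
HB.structure Definition NUAlgebra (K : fieldType) :=
  { A of GRing.Lmodule K A & Lmodule_isNUAlgebra K A }.

Notation "a ** b" := (numul a b) (at level 40, left associativity) : ring_scope.

Section LeftIdeals.
Variables (K : fieldType) (A : nualgType K).

(* Closure under scalars is not required; it is automatic in algebras with local
   units, such as Kumjian-Pask algebras. *)
Definition left_ideal (I : set A) : Prop :=
  [/\ I 0, forall x y, I x -> I y -> I (x - y)
    & forall b x, I x -> I (b ** x)].

Definition minimal_left_ideal (I : set A) : Prop :=
  [/\ left_ideal I, I <> [set 0]
    & forall J, left_ideal J -> J `<=` I -> J = [set 0] \/ J = I].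

Definition left_multiples (a : A) : set A := range (fun b => b ** a).

(* Isomorphism of left A-modules between left ideals of A; only the values of
   [f] on [I] matter. *)
Definition left_isomorphic (I J : set A) : Prop :=
  exists f : A -> A,
    [/\ set_bij I J f,
        forall x y, I x -> I y -> f (x + y) = f x + f y
      & forall b x, I x -> f (b ** x) = b ** f x].

End LeftIdeals.

Definition nzpath k (L : kgraph k) := {l : L | deg l != 0}.
HB.instance Definition _ k (L : kgraph k) := Countable.on (nzpath L).

(* [kps l] and [kpg l] stand for s_l and s_{l*}.  In [kp2_s] and [kp2_g], [lm] is
   the composite of [l] and [m], which is again of nonzero degree; it is
   quantified over only so that no proof of this is needed.  The finiteness
   hypothesis in [kp4] always holds when [L] is row-finite. *)
Record kp_family k (L : kgraph k) (K : fieldType) (A : nualgType K) := KPFamily {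
  kpp : vertex L -> A;
  kps : nzpath L -> A;
  kpg : nzpath L -> A;
  kp1 : forall v w, kpp v ** kpp w = if v == w then kpp v else 0;
  kp2_s : forall l m lm : nzpath L, src (val l) = rng (val m) ->
    val lm = kcomp (val l) (val m) -> kps l ** kps m = kps lm;
  kp2_g : forall l m lm : nzpath L, src (val l) = rng (val m) ->
    val lm = kcomp (val l) (val m) -> kpg m ** kpg l = kpg lm;
  kp2_ps : forall l, kpp (rng (val l)) ** kps l = kps l;
  kp2_sp : forall l, kps l ** kpp (src (val l)) = kps l;
  kp2_pg : forall l, kpp (src (val l)) ** kpg l = kpg l;
  kp2_gp : forall l, kpg l ** kpp (rng (val l)) = kpg l;
  kp3 : forall l m, deg (val l) = deg (val m) ->
    kpg l ** kps m = if l == m then kpp (src (val l)) else 0;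
  kp4 : forall (v : vertex L) (n : Nk k), n <> 0 ->
    finite_set (paths_from v n) ->
    kpp v = \sum_(l \in [set l : nzpath L | paths_from v n (val l)])
              (kps l ** kpg l)
}.

Inductive kp_term k (L : kgraph k) (K : fieldType) : Type :=
  | TVertex of vertex L
  | TPath of nzpath L
  | TGhost of nzpath L
  | TZero
  | TOpp of kp_term L K
  | TAdd of kp_term L K & kp_term L K
  | TScale of K & kp_term L K
  | TMul of kp_term L K & kp_term L K.

Section KumjianPask.
Variables (k : nat) (L : kgraph k) (K : fieldType).
Local Notation term := (kp_term L K).
Arguments TVertex {k L K}.
Arguments TPath {k L K}.
Arguments TGhost {k L K}.
Arguments TZero {k L K}.

HB.instance Definition _ := gen_eqMixin term.
HB.instance Definition _ := gen_choiceMixin term.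

Fixpoint kp_eval (A : nualgType K) (F : kp_family L A) (t : term) : A :=
  match t with
  | TVertex v => kpp F v
  | TPath l => kps F l
  | TGhost l => kpg F l
  | TZero => 0
  | TOpp t => - kp_eval F t
  | TAdd t u => kp_eval F t + kp_eval F u
  | TScale c t => c *: kp_eval F t
  | TMul t u => kp_eval F t ** kp_eval F u
  end.

(* The universal algebra is realised as a quotient of the formal non-unital
   algebra expressions in the generators.  Two expressions define the same
   element when they agree in every algebra with a family satisfying the
   relations; see [KP_universal] below. *)
Definition kp_equiv (t u : term) : bool :=
  `[< forall (A : nualgType K) (F : kp_family L A), kp_eval F t = kp_eval F u >].

Lemma kp_equiv_refl : reflexive kp_equiv.
Proof. by move=> t; apply/asboolP. Qed.

Lemma kp_equiv_sym : symmetric kp_equiv.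
Proof. by move=> t u; apply/asboolP/asboolP => tu A F; rewrite tu. Qed.

Lemma kp_equiv_trans : transitive kp_equiv.
Proof.
by move=> u t w /asboolP tu /asboolP uw; apply/asboolP => A F; rewrite tu uw.
Qed.

Canonical kp_equiv_rel := EquivRel kp_equiv
  kp_equiv_refl kp_equiv_sym kp_equiv_trans.

Definition KP := {eq_quot kp_equiv_rel}.
HB.instance Definition _ := Choice.on KP.

Definition KPhom (A : nualgType K) (F : kp_family L A) (a : KP) : A :=
  kp_eval F (repr a).

Lemma KPhomE A (F : kp_family L A) t : KPhom F (\pi_(KP) t) = kp_eval F t.
Proof.
rewrite /KPhom; case: piP => u /eqmodP /asboolP tu; by rewrite tu.
Qed.

Lemma KP_ext (a b : KP) :
  (forall (A : nualgType K) (F : kp_family L A), KPhom F a = KPhom F b) -> a = b.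
Proof.
move=> ab; rewrite -[a]reprK -[b]reprK; apply/eqmodP/asboolP => A F; exact: ab.
Qed.

Definition KP_zero : KP := \pi_(KP) TZero.
Definition KP_opp (a : KP) : KP := \pi_(KP) (TOpp (repr a)).
Definition KP_add (a b : KP) : KP := \pi_(KP) (TAdd (repr a) (repr b)).
Definition KP_scale (c : K) (a : KP) : KP := \pi_(KP) (TScale c (repr a)).
Definition KP_mul (a b : KP) : KP := \pi_(KP) (TMul (repr a) (repr b)).

Lemma KP_addA : associative KP_add.
Proof. by move=> a b c; apply: KP_ext => A F; rewrite !KPhomE/= -!/(KPhom F _) !KPhomE/= addrA. Qed.
Lemma KP_addC : commutative KP_add.
Proof. by move=> a b; apply: KP_ext => A F; rewrite !KPhomE/= addrC. Qed.
Lemma KP_add0 : left_id KP_zero KP_add.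
Proof. by move=> a; apply: KP_ext => A F; rewrite !KPhomE/= -!/(KPhom F _) !KPhomE/= add0r. Qed.
Lemma KP_addN : left_inverse KP_zero KP_opp KP_add.
Proof. by move=> a; apply: KP_ext => A F; rewrite !KPhomE/= -!/(KPhom F _) !KPhomE/= addNr. Qed.

HB.instance Definition _ :=
  GRing.isZmodule.Build KP KP_addA KP_addC KP_add0 KP_addN.

Lemma KP_scaleA c d a : KP_scale c (KP_scale d a) = KP_scale (c * d) a.
Proof. by apply: KP_ext => A F; rewrite !KPhomE/= -!/(KPhom F _) !KPhomE/= scalerA. Qed.
Lemma KP_scale1 : left_id 1 KP_scale.
Proof. by move=> a; apply: KP_ext => A F; rewrite !KPhomE/= scale1r. Qed.
Lemma KP_scaleDr : right_distributive KP_scale +%R.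
Proof. by move=> c a b; apply: KP_ext => A F; rewrite !KPhomE/= -!/(KPhom F _) !KPhomE/= scalerDr. Qed.
Lemma KP_scaleDl a : {morph KP_scale^~ a : c d / c + d}.
Proof. by move=> c d; apply: KP_ext => A F; rewrite !KPhomE/= -!/(KPhom F _) !KPhomE/= scalerDl. Qed.

HB.instance Definition _ := GRing.Zmodule_isLmodule.Build K KP
  KP_scaleA KP_scale1 KP_scaleDr KP_scaleDl.

Lemma KP_mulA : associative KP_mul.
Proof. by move=> a b c; apply: KP_ext => A F; rewrite !KPhomE/= -!/(KPhom F _) !KPhomE/= numulA. Qed.
Lemma KP_mulDl : left_distributive KP_mul +%R.
Proof. by move=> a b c; apply: KP_ext => A F; rewrite !KPhomE/= -!/(KPhom F _) !KPhomE/= numulDl. Qed.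
Lemma KP_mulDr : right_distributive KP_mul +%R.
Proof. by move=> a b c; apply: KP_ext => A F; rewrite !KPhomE/= -!/(KPhom F _) !KPhomE/= numulDr. Qed.
Lemma KP_scaleAl (c : K) (a b : KP) : c *: KP_mul a b = KP_mul (c *: a) b.
Proof. by apply: KP_ext => A F; rewrite !KPhomE/= -!/(KPhom F _) !KPhomE/= nuscaleAl. Qed.
Lemma KP_scaleAr (c : K) (a b : KP) : c *: KP_mul a b = KP_mul a (c *: b).
Proof. by apply: KP_ext => A F; rewrite !KPhomE/= -!/(KPhom F _) !KPhomE/= nuscaleAr. Qed.

HB.instance Definition _ := Lmodule_isNUAlgebra.Build K KP
  KP_mulA KP_mulDl KP_mulDr KP_scaleAl KP_scaleAr.

Definition nualg_hom (A B : nualgType K) (f : A -> B) : Prop :=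
  [/\ forall a b, f (a + b) = f a + f b,
      forall (c : K) a, f (c *: a) = c *: f a
    & forall a b, f (a ** b) = f a ** f b].

Lemma KPhom_hom A (F : kp_family L A) : nualg_hom (KPhom F : KP -> A).
Proof. by split=> *; rewrite KPhomE. Qed.

Definition KPp (v : vertex L) : KP := \pi_(KP) (TVertex v).
Definition KPs (l : nzpath L) : KP := \pi_(KP) (TPath l).
Definition KPg (l : nzpath L) : KP := \pi_(KP) (TGhost l).

Lemma KPhom_if A (F : kp_family L A) (b : bool) (x y : KP) :
  KPhom F (if b then x else y) = if b then KPhom F x else KPhom F y.
Proof. by case: b. Qed.

Lemma KPhom0 A (F : kp_family L A) : KPhom F (0 : KP) = 0.
Proof. exact: KPhomE. Qed.

Lemma KPhomM A (F : kp_family L A) (a b : KP) :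
  KPhom F (a ** b) = KPhom F a ** KPhom F b.
Proof. by rewrite KPhomE. Qed.

Lemma KP_kp1 v w : KPp v ** KPp w = if v == w then KPp v else 0.
Proof.
by apply: KP_ext => A F; rewrite KPhom_if KPhomM KPhom0 !KPhomE/= kp1.
Qed.

Lemma KP_kp2_s (l m lm : nzpath L) : src (val l) = rng (val m) ->
  val lm = kcomp (val l) (val m) -> KPs l ** KPs m = KPs lm.
Proof.
by move=> lm1 lm2; apply: KP_ext => A F; rewrite KPhomM !KPhomE/= (kp2_s F lm1 lm2).
Qed.

Lemma KP_kp2_g (l m lm : nzpath L) : src (val l) = rng (val m) ->
  val lm = kcomp (val l) (val m) -> KPg m ** KPg l = KPg lm.
Proof.
by move=> lm1 lm2; apply: KP_ext => A F; rewrite KPhomM !KPhomE/= (kp2_g F lm1 lm2).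
Qed.

Lemma KP_kp2_ps (l : nzpath L) : KPp (rng (val l)) ** KPs l = KPs l.
Proof. by apply: KP_ext => A F; rewrite KPhomM !KPhomE/= kp2_ps. Qed.
Lemma KP_kp2_sp (l : nzpath L) : KPs l ** KPp (src (val l)) = KPs l.
Proof. by apply: KP_ext => A F; rewrite KPhomM !KPhomE/= kp2_sp. Qed.
Lemma KP_kp2_pg (l : nzpath L) : KPp (src (val l)) ** KPg l = KPg l.
Proof. by apply: KP_ext => A F; rewrite KPhomM !KPhomE/= kp2_pg. Qed.
Lemma KP_kp2_gp (l : nzpath L) : KPg l ** KPp (rng (val l)) = KPg l.
Proof. by apply: KP_ext => A F; rewrite KPhomM !KPhomE/= kp2_gp. Qed.

Lemma KP_kp3 (l m : nzpath L) : deg (val l) = deg (val m) ->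
  KPg l ** KPs m = if l == m then KPp (src (val l)) else 0.
Proof.
by move=> lm; apply: KP_ext => A F; rewrite KPhom_if KPhomM KPhom0 !KPhomE/= kp3.
Qed.

Lemma KP_kp4 (v : vertex L) (n : Nk k) : n <> 0 ->
  finite_set (paths_from v n) ->
  KPp v = \sum_(l \in [set l : nzpath L | paths_from v n (val l)])
            (KPs l ** KPg l).
Proof.
move=> n0 fin; apply: KP_ext => A F; rewrite KPhomE/= (kp4 F n0 fin).
have fin' : finite_set [set l : nzpath L | paths_from v n (val l)].
  apply: (@finite_preimage _ _ _ val) => //.
  by move=> x y _ _; apply: val_inj.
rewrite !fsbig_finite//= (big_morph (KPhom F) (id1 := 0) (op1 := +%R)).
- by apply: eq_bigr => l _; rewrite KPhomM !KPhomE.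
- by move=> a b; have [] := KPhom_hom F.
- exact: KPhom0.
Qed.

Definition KP_family : kp_family L KP :=
  KPFamily KP_kp1 KP_kp2_s KP_kp2_g KP_kp2_ps KP_kp2_sp KP_kp2_pg KP_kp2_gp
    KP_kp3 KP_kp4.

Lemma KP_piN t : \pi_(KP) (TOpp t) = - (\pi_(KP) t : KP).
Proof. by apply: KP_ext => A F; rewrite !KPhomE/= -!/(KPhom F _) KPhomE. Qed.
Lemma KP_piD t u : \pi_(KP) (TAdd t u) = (\pi_(KP) t : KP) + (\pi_(KP) u : KP).
Proof. by apply: KP_ext => A F; rewrite !KPhomE/= -!/(KPhom F _) !KPhomE. Qed.
Lemma KP_piZ c t : \pi_(KP) (TScale c t) = c *: (\pi_(KP) t : KP).
Proof. by apply: KP_ext => A F; rewrite !KPhomE/= -!/(KPhom F _) KPhomE. Qed.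
Lemma KP_piM t u : \pi_(KP) (TMul t u) = (\pi_(KP) t : KP) ** (\pi_(KP) u : KP).
Proof. by apply: KP_ext => A F; rewrite !KPhomE/= -!/(KPhom F _) !KPhomE. Qed.

Theorem KP_universal (A : nualgType K) (F : kp_family L A) :
  exists! f : KP -> A,
    [/\ nualg_hom f, forall v, f (KPp v) = kpp F v,
        forall l, f (KPs l) = kps F l & forall l, f (KPg l) = kpg F l].
Proof.
exists (KPhom F); split.
  by split; [exact: KPhom_hom| move=> ?; rewrite KPhomE..].
move=> f [[fD fZ fM] fp fs fg]; apply/funext => a.
rewrite -[a]reprK KPhomE; elim: (repr a) => [v|l|l||t IH|t IHt u IHu|c t IH|t IHt u IHu] /=.
- by rewrite -fp.
- by rewrite -fs.
- by rewrite -fg.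
- by rewrite -[RHS]/(f 0) -(scale0r (0 : KP)) fZ scale0r.
- by rewrite KP_piN -[X in f X]scaleN1r fZ -IH scaleN1r.
- by rewrite KP_piD fD IHt IHu.
- by rewrite KP_piZ fZ IH.
- by rewrite KP_piM fM IHt IHu.
Qed.

End KumjianPask.

Arguments KPp {k L}.

(* Main.v *)
Require Import Defs.
From HB Require Import structures.
From mathcomp Require Import all_boot all_order all_algebra finmap.
From mathcomp Require Import all_classical.
From mathcomp Require Import zify.

Set Implicit Arguments.
Unset Strict Implicit.
Unset Printing Implicit Defensive.

Import GRing.Theory.
Local Open Scope classical_set_scope.
Local Open Scope ring_scope.

(** Write R for the Kumjian-Pask algebra.  Everything rests on a representation
    of R on functions of pairs (x, n), with x an infinite path and n in Z^k: s_l
    transports a function along x |-> l x and shifts n by the degree of l.  On a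
    combination a = sum_i c_i s_(l_i) of distinct paths, the value at (x, deg l_0)
    of the image of the function that tests n = 0 is c_0 whenever x starts with
    l_0 ([path_sum_delta]).  So such a combination, with a nonzero coefficient,
    is a nonzero element.

    Two facts reduce general elements to such combinations.  Multiplying on the
    right by a long path cancels all ghosts, and a nonzero element is not killed
    by all the paths of a given degree, by (KP4) and local units
    ([mul_path_reduction]).  If R a is minimal and a c <> 0, right multiplication
    by c is an isomorphism from R a to R (a c), as its kernel is a proper left
    ideal ([minimal_mulr_injective]).  Hence every minimal R a is isomorphic to
    some minimal R a' with a' = sum_i c_i s_(l_i), all the l_i having the same
    source w.

    For a minimal ideal of this form, let z be an infinite path from w.  Given a
    path out of w that starts none of the paths z' with l_i z' = l_0 z, let t be
    a long enough initial segment of l_0 z.  Right multiplication by the given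
    path kills the nonzero element t* a' but not a', which contradicts
    injectivity; so there are no infinite paths from w other than these z'
    ([minimal_finitely_many_ipaths]).  So finitely many infinite paths leave w;
    a further right multiplication by a path that separates them yields an
    a' for which w has a single infinite path x.  Then x is aperiodic
    ([minimal_aperiodic]): if it had a nonzero period t, the difference f between
    the projection onto l_0 x and the operator translating degrees by N t would
    satisfy f a' <> 0 and R f a' = R a', although f a' kills all functions
    invariant under N t and a' does not.  So w is a line point.

    Conversely, let x be the only infinite path from v and let it be aperiodic,
    and let a in R p_v be nonzero.  After reduction a becomes a combination of
    paths l_i with the infinite paths l_i y pairwise distinct, where y is a tail
    of x ([icons_aperiodic_inj]).  The ghost of a long initial segment of l_0 y
    thus isolates one term, and p_v lies in R a ([line_point_generates]); so R p_v
    is minimal.  This gives (1), as p_w is itself a combination of paths, and it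
    identifies R a' with R p_w in (2). *)

(** * Degrees *)

Section Degrees.
Variable k : nat.
Implicit Types m n p : Nk k.

Lemma NkD m n i : (m + n) i = (m i + n i)%N.
Proof. by rewrite ffunE. Qed.

Lemma Nk_addI p : injective (fun m => p + m).
Proof.
move=> m n /ffunP mn; apply/ffunP => i; apply/eqP.
by rewrite -(eqn_add2l (p i)) -!NkD mn.
Qed.

Lemma leNkP m n : reflect (exists p, n = m + p) (leNk m n).
Proof.
apply: (iffP forallP) => [mn|[p ->] i]; last by rewrite NkD leq_addr.
by exists (subNk n m); apply/ffunP => i; rewrite NkD ffunE subnKC.
Qed.

Lemma leNk_addr m n : leNk m (m + n).
Proof. by apply/leNkP; exists n. Qed.

Lemma leNk_addl m n : leNk n (m + n).
Proof. by rewrite addrC leNk_addr. Qed.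

Lemma leNk_add m n p q : leNk m n -> leNk p q -> leNk (m + p) (n + q).
Proof.
move=> /leNkP[a ->] /leNkP[b ->]; apply/leNkP; exists (a + b).
by rewrite addrACA.
Qed.

Lemma leNk_cancel p m n : leNk (p + m) (p + n) -> leNk m n.
Proof. by case/leNkP => a; rewrite -addrA => /Nk_addI ->; exact: leNk_addr. Qed.

Lemma leNk_sum (I : eqType) (s : seq I) (F : I -> Nk k) i :
  i \in s -> leNk (F i) (\sum_(j <- s) F j).
Proof. by move=> si; rewrite (big_rem i)//=; exact: leNk_addr. Qed.

Lemma Nk_mulrnE m N i : (m *+ N) i = (m i * N)%N.
Proof.
elim: N => [|N IH]; first by rewrite mulr0n ffunE muln0.
by rewrite mulrS NkD IH mulnS.
Qed.

End Degrees.

(** * Factoring paths *)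

Section Paths.
Variables (k : nat) (L : kgraph k).
Implicit Types (l m : L) (n p : Nk k) (v w : vertex L).

Lemma kcomp_inj l m l' m' : src l = rng m -> src l' = rng m' ->
  deg l = deg l' -> kcomp l m = kcomp l' m' -> l = l' /\ m = m'.
Proof.
move=> lm lm' dl E.
have dm : deg m = deg m'.
  by apply: (@Nk_addI _ (deg l)); rewrite {2}dl -!deg_comp// E.
have [[a b] [_ U]] := factorisation (deg_comp lm).
have ab : (a, b) = (l, m) by apply: U; split.
by have [] : (l, m) = (l', m') by rewrite -ab; apply: U; split.
Qed.

(** Both [idp (rng l)] followed by [l] and [l] followed by [idp (src l)] factor
    [l] in degrees 0 and 0. *)
Lemma deg0_idp l : deg l = 0 -> l = idp (rng l).
Proof.
move=> l0; apply/esym.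
have [||||-> _ //] := @kcomp_inj (idp (rng l)) l l (idp (src l)).
- by rewrite src_idp.
- by rewrite rng_idp.
- by rewrite deg_idp l0.
- by rewrite kcomp_idl kcomp_idr.
Qed.

Lemma idp_inj : injective (@idp k L).
Proof. by move=> v w /(congr1 rng); rewrite !rng_idp. Qed.

(** A junk pair when [n] is not below [deg l]. *)
Definition cut n l : L * L :=
  xget (l, idp (src l))
    [set q | [/\ src q.1 = rng q.2, deg q.1 = n & l = kcomp q.1 q.2]].
Definition pre n l : L := (cut n l).1.
Definition suf n l : L := (cut n l).2.

Lemma cutP n l : leNk n (deg l) ->
  [/\ src (pre n l) = rng (suf n l), deg (pre n l) = n
    & l = kcomp (pre n l) (suf n l)].
Proof.
case/leNkP => p E; have [q [qP _]] := factorisation E.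
apply: (@xgetPex _ _
  [set q | [/\ src q.1 = rng q.2, deg q.1 = n & l = kcomp q.1 q.2]]).
by case: qP => q1 q2 q3 q4; exists q.
Qed.

Lemma cut_comp n l m : deg l = n -> src l = rng m ->
  pre n (kcomp l m) = l /\ suf n (kcomp l m) = m.
Proof.
move=> ln lm; have [|a b c] := @cutP n (kcomp l m).
  by rewrite deg_comp// ln leNk_addr.
by apply: kcomp_inj => //; rewrite ln.
Qed.

Lemma pre_comp n l m : deg l = n -> src l = rng m -> pre n (kcomp l m) = l.
Proof. by move=> ln /(cut_comp ln)[]. Qed.

Lemma suf_comp n l m : deg l = n -> src l = rng m -> suf n (kcomp l m) = m.
Proof. by move=> ln /(cut_comp ln)[]. Qed.

Lemma suf0 l : suf 0 l = l.
Proof.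
by rewrite -[in LHS](kcomp_idl l) suf_comp ?deg_idp ?src_idp.
Qed.

Lemma rng_pre n l : leNk n (deg l) -> rng (pre n l) = rng l.
Proof. by move=> /cutP[a b c]; rewrite [in RHS]c rng_comp. Qed.

Lemma deg_suf n p l : deg l = n + p -> deg (suf n l) = p.
Proof.
move=> ln; have [|a b c] := @cutP n l; first by rewrite ln leNk_addr.
by apply: (@Nk_addI _ n); rewrite -ln [in RHS]c deg_comp// b.
Qed.

Lemma pre_pre n p l : leNk n p -> leNk p (deg l) -> pre n (pre p l) = pre n l.
Proof.
move=> np /cutP[a b c].
have [|a' b' c'] := @cutP n (pre p l); first by rewrite b.
have E : src (suf n (pre p l)) = rng (suf p l).
  by rewrite -a [in RHS]c' src_comp.
have lE : l = kcomp (pre n (pre p l)) (kcomp (suf n (pre p l)) (suf p l)).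
  by rewrite kcompA// -c'.
by rewrite [RHS](congr1 (pre n) lE) pre_comp// rng_comp.
Qed.

End Paths.

(** * Infinite paths as coherent families of finite paths *)

Section InfinitePaths.
Variables (k : nat) (L : kgraph k).
Implicit Types (l m : L) (n p : Nk k) (v w : vertex L).

(** The initial segments x(0, n) determine an infinite path x, so a coherent
    choice of them encodes the functor; prepending a path and shifting then
    become operations on finite paths. *)
Record ipath := IPath {
  ip :> Nk k -> L;
  ip_deg : forall n, deg (ip n) = n;
  ip_pre : forall n p, pre n (ip (n + p)) = ip n
}.
Implicit Types x y z : ipath.

Lemma ipath_ext x y : (forall n, x n = y n) -> x = y.
Proof.
case: x => x xd xp; case: y => y yd yp /= /funext xy.
move: xd xp; rewrite xy => xd xp.
by rewrite (Prop_irrelevance xd yd) (Prop_irrelevance xp yp).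
Qed.

(** Initial segments beyond [p] determine all the others.  This is how paths of
    the form l x are compared: beyond [deg l] they are given by composition. *)
Lemma ipath_ext_above p x y : (forall n, x (p + n) = y (p + n)) -> x = y.
Proof.
move=> xy; apply: ipath_ext => n.
by rewrite -(ip_pre x n p) -(ip_pre y n p) addrC xy.
Qed.

Lemma ipath_neq_above n p x y : leNk n p -> x n <> y n -> x p <> y p.
Proof.
by case/leNkP => a -> xy E; apply: xy; rewrite -(ip_pre x n a) E ip_pre.
Qed.

Lemma ipath_neqP x y : x <> y -> exists n, x n <> y n.
Proof.
move=> xy; apply: contrapT => /forallNP H; apply: xy.
by apply: ipath_ext => n; apply: contrapT; exact: H.
Qed.

Definition irng x : vertex L := rng (x 0).

Lemma rng_ip x n : rng (x n) = irng x.
Proof.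
rewrite /irng -(ip_pre x 0 n) add0r rng_pre// ip_deg.
by apply/leNkP; exists n; rewrite add0r.
Qed.

Lemma ip0 x : x 0 = idp (irng x).
Proof. by rewrite /irng [LHS]deg0_idp ?ip_deg. Qed.

Lemma ip_cut x n p :
  src (x n) = rng (suf n (x (n + p))) /\
  x (n + p) = kcomp (x n) (suf n (x (n + p))).
Proof.
have [|a b c] := @cutP _ _ n (x (n + p)); first by rewrite ip_deg leNk_addr.
by rewrite ip_pre in a c.
Qed.

Lemma ishift_deg x n p : deg (suf n (x (n + p))) = p.
Proof. by rewrite (@deg_suf _ _ n p)// ip_deg. Qed.

Lemma ishift_pre x n p q :
  pre p (suf n (x (n + (p + q)))) = suf n (x (n + p)).
Proof.
have [a1 a2] := ip_cut x n (p + q); have [b1 b2] := ip_cut x n p.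
have [c1 c2] := ip_cut x (n + p) q.
have bc : src (suf n (x (n + p))) = rng (suf (n + p) (x (n + p + q))).
  by rewrite -c1 [in RHS]b2 src_comp.
have : kcomp (x n) (suf n (x (n + (p + q)))) =
    kcomp (x n) (kcomp (suf n (x (n + p))) (suf (n + p) (x (n + p + q)))).
  by rewrite kcompA// -b2 -c2 -a2 addrA.
move=> /kcomp_inj[]//; first by rewrite rng_comp.
by move=> _ ->; rewrite pre_comp ?ishift_deg.
Qed.

Definition ishift n x : ipath := IPath (ishift_deg x n) (ishift_pre x n).

Lemma ipD x n p : x (n + p) = kcomp (x n) (ishift n x p).
Proof. by have [] := ip_cut x n p. Qed.

Lemma src_ip x n : src (x n) = irng (ishift n x).
Proof. by rewrite -(rng_ip _ 0); have [] := ip_cut x n 0. Qed.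

Lemma src_ip_rng x n p : src (x n) = rng (ishift n x p).
Proof. by rewrite rng_ip src_ip. Qed.

Lemma ishiftD n p x : ishift p (ishift n x) = ishift (n + p) x.
Proof.
apply: ipath_ext => q.
have r1 := src_ip_rng x n p; have r2 := src_ip_rng (ishift n x) p q.
have r3 : src (ishift n x p) = rng (ishift (n + p) x q).
  by rewrite -(src_ip_rng x (n + p)) ipD src_comp.
have : kcomp (x n) (kcomp (ishift n x p) (ishift p (ishift n x) q)) =
    kcomp (x n) (kcomp (ishift n x p) (ishift (n + p) x q)).
  by rewrite -ipD -ipD kcompA// -ipD -ipD addrA.
by move=> /kcomp_inj[]//; rewrite ?rng_comp// => _ /kcomp_inj[].
Qed.

Lemma ishift0 x : ishift 0 x = x.
Proof.
by apply: ipath_ext => n; rewrite -[LHS]/(suf 0 (x (0 + n))) suf0 add0r.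
Qed.

Lemma icons_deg l x n : src l = irng x -> deg (pre n (kcomp l (x n))) = n.
Proof.
move=> lx; have [] // := @cutP _ _ n (kcomp l (x n)).
by rewrite deg_comp ?rng_ip// ip_deg leNk_addl.
Qed.

Lemma icons_pre l x n p : src l = irng x ->
  pre n (pre (n + p) (kcomp l (x (n + p)))) = pre n (kcomp l (x n)).
Proof.
move=> lx; rewrite pre_pre ?leNk_addr//; last first.
  by rewrite deg_comp ?rng_ip// ip_deg leNk_addl.
rewrite ipD kcompA ?rng_ip ?src_ip// -(@pre_pre _ _ n (deg l + n)).
- by rewrite pre_comp// ?deg_comp ?src_comp ?rng_ip ?ip_deg// src_ip.
- by rewrite leNk_addl.
- by rewrite !deg_comp ?src_comp ?rng_ip ?ip_deg ?src_ip// leNk_addr.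
Qed.

(** The infinite path l x; total, with the junk value [x] when [l] and [x] do not
    compose. *)
Definition icons l x : ipath :=
  match pselect (src l = irng x) with
  | left lx => IPath (fun n => icons_deg n lx) (fun n p => icons_pre n p lx)
  | right _ => x
  end.

Lemma iconsD l x n : src l = irng x -> icons l x (deg l + n) = kcomp l (x n).
Proof.
rewrite /icons; case: pselect => // lx _ /=.
rewrite addrC ipD kcompA ?rng_ip ?src_ip// pre_comp//.
- by rewrite deg_comp ?rng_ip// ip_deg addrC.
- by rewrite src_comp ?rng_ip// src_ip.
Qed.

Lemma icons_deg_id l x : src l = irng x -> icons l x (deg l) = l.
Proof. by move=> lx; rewrite -[deg l]addr0 iconsD// ip0 -lx kcomp_idr. Qed.

Lemma irng_icons l x : src l = irng x -> irng (icons l x) = rng l.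
Proof. by move=> lx; rewrite -(rng_ip _ (deg l)) icons_deg_id. Qed.

Lemma ishift_icons l x : src l = irng x -> ishift (deg l) (icons l x) = x.
Proof.
move=> lx; apply: ipath_ext => n.
have := ipD (icons l x) (deg l) n; rewrite iconsD// icons_deg_id//.
move=> /kcomp_inj[]//; first by rewrite rng_ip.
by rewrite -{1}(icons_deg_id lx) -src_ip_rng.
Qed.

Lemma icons_ishift x n : icons (x n) (ishift n x) = x.
Proof.
apply: (@ipath_ext_above n) => p.
by have := iconsD p (src_ip x n); rewrite ip_deg => ->; rewrite ipD.
Qed.

Lemma icons_comp l m x : src l = rng m -> src m = irng x ->
  icons (kcomp l m) x = icons l (icons m x).
Proof.
move=> lm mx; apply: (@ipath_ext_above (deg l + deg m)) => n.
have := @iconsD (kcomp l m) x n; rewrite deg_comp ?src_comp// => ->//.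
by rewrite -addrA iconsD ?irng_icons// iconsD// kcompA// rng_ip.
Qed.

Lemma icons_idp x : icons (idp (irng x)) x = x.
Proof. by rewrite -ip0 -{2}(ishift0 x) icons_ishift. Qed.

Section Existence.
Hypothesis hL : row_finite_no_sources L.
Variable v : vertex L.

Let ones : Nk k := [ffun=> 1%N].

Let extend w : {l : L | rng l = w /\ deg l = ones}.
Proof. by apply: cid; have [] := hL w ones. Qed.

(** In the absence of sources a path can be prolonged by degree (1, ..., 1) for
    ever, and the degrees reached are cofinal in N^k. *)
Fixpoint diagonal_path (i : nat) : L :=
  if i is j.+1 then
    kcomp (diagonal_path j) (sval (extend (src (diagonal_path j))))
  else idp v.

Lemma diagonal_pathS i j :
  deg (diagonal_path i) = ones *+ i /\
  exists2 m, src (diagonal_path i) = rng m &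
             diagonal_path (i + j) = kcomp (diagonal_path i) m.
Proof.
have deg_c : deg (diagonal_path i) = ones *+ i.
  elim: i => [|i IH]; first by rewrite mulr0n deg_idp.
  rewrite /=; case: (extend _) => e [e1 e2] /=.
  by rewrite deg_comp// IH e2 mulrSr.
split=> //; elim: j => [|j [m m1 m2]].
  exists (idp (src (diagonal_path i))); first by rewrite rng_idp.
  by rewrite addn0 kcomp_idr.
rewrite addnS /=; case: (extend _) => e [/= + e2]; rewrite m2 src_comp// => e1.
by exists (kcomp m e); rewrite ?rng_comp// kcompA.
Qed.

Lemma leNk_ones n i : (\sum_j n j <= i)%N -> leNk n (ones *+ i).
Proof.
move=> ni; apply/forallP => j; rewrite Nk_mulrnE ffunE mul1n.
by apply: leq_trans ni; rewrite (bigD1 j)//= leq_addr.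
Qed.

Lemma pre_diagonal_path n i j : (\sum_j n j <= i <= j)%N ->
  pre n (diagonal_path j) = pre n (diagonal_path i).
Proof.
case/andP => ni ij; have [di [m m1]] := diagonal_pathS i (j - i).
rewrite subnKC// => E.
rewrite -(@pre_pre _ _ n (ones *+ i)); last first.
- by have [-> _] := diagonal_pathS j 0; rewrite -(subnKC ij) mulrnDr leNk_addr.
- exact: leNk_ones.
by rewrite E pre_comp.
Qed.

Lemma ipath_exists : exists x, irng x = v.
Proof.
pose f n := pre n (diagonal_path (\sum_i n i)).
have fd n : deg (f n) = n.
  have [] // := @cutP _ _ n (diagonal_path (\sum_i n i)).
  by have [-> _] := diagonal_pathS (\sum_i n i) 0; apply: leNk_ones.
have fp n p : pre n (f (n + p)) = f n.
  rewrite /f pre_pre ?leNk_addr//; last first.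
    have [-> _] := diagonal_pathS (\sum_i (n + p : Nk k)%R i) 0.
    exact: leNk_ones.
  apply: pre_diagonal_path; rewrite leqnn/=.
  by apply: leq_sum => i _; rewrite NkD leq_addr.
exists (IPath fd fp); rewrite /irng /= /f.
have -> : (\sum_i (0 : Nk k)%R i = 0)%N by apply: big1 => i _; rewrite ffunE.
rewrite /= rng_pre ?rng_idp//.
by apply/leNkP; exists (deg (idp v)); rewrite add0r.
Qed.

End Existence.

End InfinitePaths.

Arguments ishift : simpl never.
Arguments icons : simpl never.

(** * Infinite paths as functors *)

Section Functors.
Variables (k : nat) (L : kgraph k).
Implicit Types (x : Omega k -> L) (z : ipath L) (n p : Nk k) (f g : Omega k).

Definition functor_of z : Omega k -> L :=
  fun f => suf (Omega_rng f) (z (Omega_src f)).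

Lemma Omega_src_rng f : exists p, Omega_src f = Omega_rng f + p.
Proof. exact/leNkP/(valP f). Qed.

Lemma functor_ofE z f p : Omega_src f = Omega_rng f + p ->
  functor_of z f = ishift (Omega_rng f) z p.
Proof. by move=> fp; rewrite /functor_of fp. Qed.

Lemma Omega_degE f p : Omega_src f = Omega_rng f + p -> Omega_deg f = p.
Proof.
by move=> fp; apply/ffunP => i; rewrite !ffunE fp NkD addKn.
Qed.

Lemma functor_ofP z : infinite_paths L (functor_of z).
Proof.
exists (fun n => irng (ishift n z)); split.
- by move=> n; rewrite (@functor_ofE _ _ 0) ?addr0// ip0.
- move=> f; have [p fp] := Omega_src_rng f.
  rewrite (functor_ofE _ fp) rng_ip src_ip; split=> //.
  by rewrite ishiftD -fp.
- move=> f g fg; have [p fp] := Omega_src_rng f; have [q gq] := Omega_src_rng g.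
  have rfg : Omega_rng (kcomp f g) = Omega_rng f := Omega_rng_comp fg.
  have sfg : Omega_src (kcomp f g) = Omega_src g := Omega_src_comp fg.
  rewrite (functor_ofE _ fp) (functor_ofE _ gq) (@functor_ofE _ _ (p + q)).
    by rewrite rfg ipD ishiftD -fp -[Omega_src f]/(src f) fg.
  by rewrite rfg sfg gq -[Omega_rng g]fg -[src f]/(Omega_src f) fp addrA.
- move=> f; have [p fp] := Omega_src_rng f.
  by rewrite (functor_ofE _ fp) ip_deg; apply/esym/Omega_degE.
Qed.

Lemma leNk0 n : leNk 0 n.
Proof. by apply/forallP => i; rewrite ffunE. Qed.

Lemma functor_of0 z n : functor_of z (Omega_arrow (leNk0 n)) = z n.
Proof. by rewrite -[LHS]/(suf 0 (z n)) suf0. Qed.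

Lemma functor_of_inj : injective functor_of.
Proof.
move=> z z' zz; apply: ipath_ext => n.
by rewrite -!functor_of0 zz.
Qed.

Lemma functor_of_surj x : infinite_paths L x -> exists z, x = functor_of z.
Proof.
move=> [x0 [xid xrs xc xd]].
have sp n m (nm : leNk n m) : x (Omega_arrow (leNk0 m)) =
    kcomp (x (Omega_arrow (leNk0 n))) (x (Omega_arrow nm)).
  rewrite -xc//; congr x; apply: val_inj.
  by rewrite val_Omega_comp.
have rs n m (nm : leNk n m) :
    src (x (Omega_arrow (leNk0 n))) = rng (x (Omega_arrow nm)).
  have [_ ->] := xrs (Omega_arrow (leNk0 n)).
  by have [-> _] := xrs (Omega_arrow nm).
have d n : deg (x (Omega_arrow (leNk0 n))) = n.
  by rewrite xd; apply: Omega_degE; rewrite [Omega_rng _]/= add0r.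
have c n p : pre n (x (Omega_arrow (leNk0 (n + p)))) = x (Omega_arrow (leNk0 n)).
  by rewrite (sp n _ (leNk_addr n p)) pre_comp.
exists (IPath d c); apply/funext => -[[m n] /= mn].
by rewrite /functor_of /= (sp _ _ mn) suf_comp.
Qed.

Lemma functor_of_id0 z : functor_of z (Omega_id 0) = idp (irng z).
Proof. by rewrite -[LHS]/(suf 0 (z 0)) suf0 ip0. Qed.

Lemma shift_functor_of p z : shift p (functor_of z) = functor_of (ishift p z).
Proof.
apply/funext => f; have [q fq] := Omega_src_rng f.
have rf : Omega_rng (Omega_translate p f) = Omega_rng f + p by [].
rewrite (functor_ofE _ fq) /shift (@functor_ofE _ _ q) rf.
  by rewrite ishiftD addrC.
by rewrite addrAC -fq.
Qed.

Lemma line_pointsP v : line_points L v <-> exists z,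
  [/\ irng z = v, forall y, irng y = v -> y = z
    & forall p q, ishift p z = ishift q z -> p = q].
Proof.
have fromP z : infinite_paths_from v (functor_of z) <-> irng z = v.
  split; first by case=> _; rewrite functor_of_id0 => /idp_inj.
  by move=> zv; split; [exact: functor_ofP|rewrite functor_of_id0 zv].
split=> [[x [vx ax]]|[z [zv zu za]]].
  have : infinite_paths_from v x by rewrite vx.
  move=> xv; have [z xz] := functor_of_surj xv.1; subst x.
  exists z; split; first exact/fromP.
    by move=> y /fromP; rewrite vx => /functor_of_inj.
  move=> p q pq; apply: contrapT => npq; apply: ax.
  by exists p, q; rewrite !shift_functor_of pq.
exists (functor_of z); split.
  apply/seteqP; split=> [x xv|x ->]; last exact/fromP.
  have [y xy] := functor_of_surj xv.1; subst x.
  by move/fromP : xv => /zu ->.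
by move=> [p [q [npq]]]; rewrite !shift_functor_of => /functor_of_inj /za.
Qed.

End Functors.

(** * The algebra of linear operators on a vector space *)

Section Endomorphisms.
Variables (K : fieldType) (V : lmodType K).

Definition linear_maps : {pred V -> V} := fun f => `[< linear f >].

Lemma linear_maps_submod : submod_closed linear_maps.
Proof.
split=> [|c f g /asboolP fl /asboolP gl]; apply/asboolP => a u v.
  by rewrite scaler0 addr0.
change (c *: f (a *: u + v) + g (a *: u + v) =
  a *: (c *: f u + g u) + (c *: f v + g v)).
by rewrite fl gl !scalerDr !scalerA [c * a]mulrC addrACA.
Qed.

HB.instance Definition _ :=
  GRing.isSubmodClosed.Build K (V -> V) linear_maps
    (GRing.submod_closed_semi linear_maps_submod).

Record endo := Endo { endo_fun :> V -> V; _ : endo_fun \in linear_maps }.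
HB.instance Definition _ := [isSub for endo_fun].
HB.instance Definition _ := [Choice of endo by <:].
HB.instance Definition _ := [SubChoice_isSubLmodule of endo by <:].

Lemma endo_ext (f g : endo) : (forall u, f u = g u) -> f = g.
Proof. by move=> fg; apply: val_inj; apply/funext. Qed.

Lemma endo_linear (f : endo) : linear f.
Proof. exact/asboolP/(valP f). Qed.

Lemma endo0 (f : endo) : f 0 = 0.
Proof.
have := endo_linear f 1 0 0; rewrite !scale1r addr0 => f00.
by apply: (@addrI _ (f 0)); rewrite addr0 -f00.
Qed.

Lemma endo_mul_subproof (f g : endo) : (f \o g) \in linear_maps.
Proof. by apply/asboolP => a u v /=; rewrite !endo_linear. Qed.

Definition endo_mul (f g : endo) : endo := Endo (endo_mul_subproof f g).

Lemma endo_mulA : associative endo_mul.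
Proof. by move=> f g h; apply: endo_ext. Qed.

Lemma endo_mulDl : left_distributive endo_mul +%R.
Proof. by move=> f g h; apply: endo_ext. Qed.

Lemma endo_mulDr : right_distributive endo_mul +%R.
Proof.
move=> f g h; apply: endo_ext => u.
by have := endo_linear f 1 (g u) (h u); rewrite !scale1r.
Qed.

Lemma endo_scaleAl (c : K) f g : c *: endo_mul f g = endo_mul (c *: f) g.
Proof. exact: endo_ext. Qed.

Lemma endo_scaleAr (c : K) f g : c *: endo_mul f g = endo_mul f (c *: g).
Proof.
apply: endo_ext => u.
by have := endo_linear f c (g u) 0; rewrite endo0 !addr0.
Qed.

HB.instance Definition _ := Lmodule_isNUAlgebra.Build K endo
  endo_mulA endo_mulDl endo_mulDr endo_scaleAl endo_scaleAr.

End Endomorphisms.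

(** * The representation on functions of infinite paths and degrees *)

Section Representation.
Variables (k : nat) (L : kgraph k) (K : fieldType).
Implicit Types (l m : L) (v w : vertex L) (x y z : ipath L).

Definition Zk := {ffun 'I_k -> int}.
HB.instance Definition _ := GRing.Zmodule.on Zk.

Definition zdeg (n : Nk k) : Zk := [ffun i => (n i)%:Z].

Lemma zdegD (m n : Nk k) : zdeg (m + n) = zdeg m + zdeg n.
Proof. by apply/ffunP => i; rewrite !ffunE. Qed.

Lemma zdeg0 : zdeg 0 = 0.
Proof. by apply/ffunP => i; rewrite !ffunE. Qed.

Lemma zdeg_inj : injective zdeg.
Proof.
by move=> m n /ffunP mn; apply/ffunP => i; have := mn i; rewrite !ffunE => -[].
Qed.

(** The factor [Zk k] records degrees.  Without it the representation would not be
    faithful: s_mu s_nu* and p_v act in the same way on functions of infinite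
    paths alone when the only path from v is mu y = nu y, whatever the degrees of
    mu and nu. *)
Definition path_fun := ipath L * Zk -> K^o.
HB.instance Definition _ := GRing.Lmodule.on path_fun.
Implicit Types f g : path_fun.

Definition vertex_fun v f : path_fun := fun q =>
  if irng q.1 == v then f q else 0.
Definition path_act l f : path_fun := fun q =>
  if q.1 (deg l) == l then f (ishift (deg l) q.1, q.2 - zdeg (deg l)) else 0.
Definition ghost_act l f : path_fun := fun q =>
  if irng q.1 == src l then f (icons l q.1, q.2 + zdeg (deg l)) else 0.

Lemma vertex_funE v f z n :
  vertex_fun v f (z, n) = if irng z == v then f (z, n) else 0.
Proof. by []. Qed.

Lemma path_actE l f z n : path_act l f (z, n) =
  if z (deg l) == l then f (ishift (deg l) z, n - zdeg (deg l)) else 0.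
Proof. by []. Qed.

Lemma ghost_actE l f z n : ghost_act l f (z, n) =
  if irng z == src l then f (icons l z, n + zdeg (deg l)) else 0.
Proof. by []. Qed.

Lemma vertex_fun_linear v : vertex_fun v \in @linear_maps K path_fun.
Proof.
apply/asboolP => a f g; apply/funext => q; rewrite /vertex_fun.
change ((if irng q.1 == v then (a *: f + g) q else 0) =
  a *: vertex_fun v f q + vertex_fun v g q); rewrite /vertex_fun.
by case: eqP => // _; rewrite scaler0 addr0.
Qed.

Lemma path_act_linear l : path_act l \in @linear_maps K path_fun.
Proof.
apply/asboolP => a f g; apply/funext => q.
change (path_act l (a *: f + g) q = a *: path_act l f q + path_act l g q).
by rewrite /path_act; case: eqP => // _; rewrite scaler0 addr0.
Qed.

Lemma ghost_act_linear l : ghost_act l \in @linear_maps K path_fun.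
Proof.
apply/asboolP => a f g; apply/funext => q.
change (ghost_act l (a *: f + g) q = a *: ghost_act l f q + ghost_act l g q).
by rewrite /ghost_act; case: eqP => // _; rewrite scaler0 addr0.
Qed.

Definition rep_p v : endo path_fun := Endo (vertex_fun_linear v).
Definition rep_s (l : nzpath L) : endo path_fun := Endo (path_act_linear (val l)).
Definition rep_g (l : nzpath L) : endo path_fun := Endo (ghost_act_linear (val l)).

Lemma path_act_comp l m f : src l = rng m ->
  path_act l (path_act m f) = path_act (kcomp l m) f.
Proof.
move=> lm; apply/funext => -[z n]; rewrite !path_actE deg_comp// ipD ishiftD.
rewrite zdegD opprD addrA.
have [zl|zl] := eqVneq (z (deg l)) l; last first.
  case: eqP => // /kcomp_inj[]//; rewrite -?src_ip_rng ?ip_deg// => E.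
  by rewrite E eqxx in zl.
case: eqP => [->|zm]; first by rewrite zl eqxx.
case: eqP => // /kcomp_inj[]//; by rewrite -?src_ip_rng ?ip_deg.
Qed.

Lemma ghost_act_comp l m f : src l = rng m ->
  ghost_act m (ghost_act l f) = ghost_act (kcomp l m) f.
Proof.
move=> lm; apply/funext => -[z n]; rewrite !ghost_actE deg_comp// src_comp//.
case: eqP => // zm; rewrite irng_icons// lm eqxx icons_comp// zdegD.
by rewrite addrAC -addrA [in X in n + X]addrC addrA addrAC.
Qed.

Lemma ghost_path_act l m f : deg l = deg m ->
  ghost_act l (path_act m f) = if l == m then vertex_fun (src l) f else 0.
Proof.
move=> dlm; apply/funext => -[z n]; rewrite ghost_actE path_actE.
case: eqP => zl; last by case: eqP => _ //; rewrite vertex_funE; case: eqP.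
rewrite -dlm icons_deg_id// ishift_icons// addrK.
by case: eqP => // _; rewrite vertex_funE zl eqxx.
Qed.

Lemma path_ghost_act l f z n :
  path_act l (ghost_act l f) (z, n) = if z (deg l) == l then f (z, n) else 0.
Proof.
rewrite path_actE ghost_actE; case: eqP => // zl.
by rewrite -src_ip zl eqxx -{1}zl icons_ishift subrK.
Qed.

Lemma rep_kp1 v w : rep_p v ** rep_p w = if v == w then rep_p v else 0.
Proof.
apply: endo_ext => f; apply/funext => q.
transitivity (vertex_fun v (vertex_fun w f) q) => //.
case: eqP => [->|vw].
  transitivity (vertex_fun w f q) => //.
  by rewrite /vertex_fun; case: eqP.
by rewrite /vertex_fun; case: eqP => // ->; case: eqP.
Qed.

(** An infinite path from [v] has exactly one initial segment of degree [n]. *)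
Lemma rep_kp4 v (n : Nk k) : n <> 0 -> finite_set (paths_from v n) ->
  rep_p v = \sum_(l \in [set l : nzpath L | paths_from v n (val l)])
              (rep_s l ** rep_g l).
Proof.
move=> n0 fin; apply: endo_ext => f; apply/funext => -[z p].
have fin' : finite_set [set l : nzpath L | paths_from v n (val l)].
  by apply: (@finite_preimage _ _ _ val) => // l m _ _; apply: val_inj.
rewrite fsbig_finite//=; set s := (X in \sum_(l <- X) _).
have s_uniq : uniq s by exact: fset_uniq.
have sP (l : nzpath L) : l \in s -> paths_from v n (val l).
  by rewrite /s in_fset_set// inE.
have sz (nz : deg (z n) != 0) : irng z = v -> (Sub (z n) nz : nzpath L) \in s.
  by move=> zv; rewrite /s in_fset_set// inE /= /paths_from /= rng_ip ip_deg.
transitivity (\sum_(l <- s) path_act (val l) (ghost_act (val l) f) (z, p)).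
  transitivity (\sum_(l <- s) if z n == val l then f (z, p) else 0).
    rewrite [LHS]vertex_funE; case: eqP => zv.
      have nz : deg (z n) != 0 by rewrite ip_deg; exact/eqP.
      rewrite (bigD1_seq (Sub (z n) nz : nzpath L)) /= ?sz// eqxx.
      rewrite big1 ?addr0// => l /eqP lz.
      by case: eqP => // zl; case: lz; apply: val_inj; exact: esym.
    rewrite [RHS]big_seq big1// => l /sP[lv _].
    by case: eqP => // zl; case: zv; rewrite -(rng_ip z n) zl.
  rewrite [LHS]big_seq [RHS]big_seq; apply: eq_bigr => l /sP[_ ln].
  by rewrite path_ghost_act ln.
elim: (s : seq _) => [|l t IH]; first by rewrite !big_nil.
by rewrite !big_cons IH.
Qed.

Definition rep_family : kp_family L (endo path_fun).
Proof.
apply: (@KPFamily _ _ _ _ rep_p rep_s rep_g).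
- exact: rep_kp1.
- move=> l m lm ls lE; apply: endo_ext => f.
  by rewrite [RHS]/= lE -path_act_comp.
- move=> l m lm ls lE; apply: endo_ext => f.
  by rewrite [RHS]/= lE -ghost_act_comp.
- move=> l; apply: endo_ext => f; apply/funext => -[z n].
  change (vertex_fun (rng (val l)) (path_act (val l) f) (z, n) =
    path_act (val l) f (z, n)).
  rewrite vertex_funE path_actE.
  case: (z _ =P _) => [E|]; last by case: ifP.
  by rewrite -(rng_ip z (deg (val l))) E eqxx.
- move=> l; apply: endo_ext => f; apply/funext => -[z n].
  change (path_act (val l) (vertex_fun (src (val l)) f) (z, n) =
    path_act (val l) f (z, n)).
  rewrite !path_actE vertex_funE; case: (z _ =P _) => [E|]//.
  by rewrite -src_ip E eqxx.
- move=> l; apply: endo_ext => f; apply/funext => -[z n].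
  change (vertex_fun (src (val l)) (ghost_act (val l) f) (z, n) =
    ghost_act (val l) f (z, n)).
  by rewrite vertex_funE ghost_actE; case: eqP.
- move=> l; apply: endo_ext => f; apply/funext => -[z n].
  change (ghost_act (val l) (vertex_fun (rng (val l)) f) (z, n) =
    ghost_act (val l) f (z, n)).
  rewrite !ghost_actE vertex_funE.
  by case: eqP => // E; rewrite irng_icons// eqxx.
- move=> l m lm; apply: endo_ext => f.
  transitivity (ghost_act (val l) (path_act (val m) f)) => //.
  by rewrite ghost_path_act// -(inj_eq val_inj); case: ifP.
- exact: rep_kp4.
Defined.

End Representation.

(** * Left ideals of non-unital algebras *)

Section NonUnital.
Variables (K : fieldType) (A : nualgType K).
Implicit Types (a b c x y : A) (I J : set A).

Lemma numul0r a : 0 ** a = 0.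
Proof. by apply: (@addrI _ (0 ** a)); rewrite -numulDl !addr0. Qed.

Lemma numulr0 a : a ** 0 = 0.
Proof. by apply: (@addrI _ (a ** 0)); rewrite -numulDr !addr0. Qed.

Lemma numulNr a b : (- a) ** b = - (a ** b).
Proof. by rewrite -scaleN1r -nuscaleAl scaleN1r. Qed.

Lemma numulBl a b c : (a - b) ** c = a ** c - b ** c.
Proof. by rewrite numulDl numulNr. Qed.

Lemma numul_suml (I : Type) (s : seq I) (P : pred I) (F : I -> A) a :
  (\sum_(i <- s | P i) F i) ** a = \sum_(i <- s | P i) (F i ** a).
Proof.
by apply: (big_morph (fun x => x ** a)) => [x y|]; rewrite ?numulDl ?numul0r.
Qed.

Lemma numul_sumr (I : Type) (s : seq I) (P : pred I) (F : I -> A) a :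
  a ** (\sum_(i <- s | P i) F i) = \sum_(i <- s | P i) (a ** F i).
Proof.
by apply: (big_morph (fun x => a ** x)) => [x y|]; rewrite ?numulDr ?numulr0.
Qed.

Lemma left_multiples_ideal a : left_ideal (left_multiples a).
Proof.
split=> [|_ _ [b _ <-] [c _ <-]|b _ [c _ <-]].
- by exists 0 => //; rewrite numul0r.
- by exists (b - c) => //; rewrite numulBl.
- by exists (b ** c) => //; rewrite numulA.
Qed.

Lemma left_ideal_sub_multiples I a : left_ideal I -> I a ->
  left_multiples a `<=` I.
Proof. by move=> [_ _ IM] Ia _ [b _ <-]; exact: IM. Qed.

Lemma left_idealD I x y : left_ideal I -> I x -> I y -> I (x + y).
Proof.
move=> [I0 IB _] Ix Iy; rewrite -[y]opprK; apply: (IB) => //.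
by rewrite -sub0r; exact: IB.
Qed.

Lemma minimal_left_ideal_multiples I a : minimal_left_ideal I -> I a ->
  left_multiples a <> [set 0] -> left_multiples a = I.
Proof.
move=> [Il _ Imin] Ia a0.
by case: (Imin _ (left_multiples_ideal a) (left_ideal_sub_multiples Il Ia)).
Qed.

Lemma left_isomorphic_sym I J : left_ideal I ->
  left_isomorphic I J -> left_isomorphic J I.
Proof.
move=> Il [f [[f1 f2 f3] fD fM]].
have /choice[g gP] : forall y, exists x, J y -> I x /\ f x = y.
  move=> y; have [Jy|nJy] := pselect (J y); last by exists 0.
  by have [x Ix <-] := f3 _ Jy; exists x.
have gf x : I x -> g (f x) = x.
  move=> Ix; have [|Ig fg] := gP (f x); first exact: f1.
  by apply: f2; rewrite ?inE.
exists g; split.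
- split.
  + by move=> y Jy; have [] := gP _ Jy.
  + move=> y z; rewrite !inE => Jy Jz gyz.
    by have [_ <-] := gP _ Jy; have [_ <-] := gP _ Jz; rewrite gyz.
  + by move=> x Ix; exists (f x); [exact: f1|exact: gf].
- move=> y z Jy Jz; have [Iy fy] := gP _ Jy; have [Iz fz] := gP _ Jz.
  by rewrite -{1}fy -{1}fz -fD// gf//; exact: left_idealD.
- move=> b y Jy; have [Iy fy] := gP _ Jy.
  by rewrite -{1}fy -fM// gf//; case: Il => _ _; apply.
Qed.

(** The inverse image of a left ideal under a module map is a left ideal. *)
Lemma minimal_left_ideal_iso I J : left_isomorphic I J -> left_ideal J ->
  minimal_left_ideal I -> minimal_left_ideal J.
Proof.
move=> [f [[f1 f2 f3] fD fM]] Jl [Il I0 Imin].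
have [I0' IB IM] := Il; have [J0' JB JM] := Jl.
have f0 : f 0 = 0 by apply: (@addrI _ (f 0)); rewrite -fD// !addr0.
have fB x y : I x -> I y -> f (x - y) = f x - f y.
  move=> Ix Iy; apply: (@addIr _ (f y)); rewrite -fD ?subrK//.
  exact: IB.
split=> //.
  move=> JE; apply: I0; apply/seteqP; split=> [x Ix|_ ->//].
  have : J (f x) by exact: f1.
  by rewrite JE /= => fx; apply: (f2 x 0); rewrite ?inE// fx f0.
move=> M Ml MJ; have [M0 MB MM] := Ml.
have Nl : left_ideal [set x | I x /\ M (f x)].
  split=> [|x y [Ix Mx] [Iy My]|b x [Ix Mx]] /=.
  - by rewrite f0.
  - by rewrite fB//; split; [exact: IB|exact: MB].
  - by rewrite fM//; split; [exact: IM|exact: MM].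
have [|NE|NE] := Imin _ Nl; first by move=> x [].
  left; apply/seteqP; split=> [y My|_ ->//].
  have [x Ix xy] := f3 _ (MJ _ My).
  have : [set x | I x /\ M (f x)] x by rewrite /= xy.
  by rewrite NE /= => x0; rewrite -xy x0.
right; apply/seteqP; split=> // y Jy.
have [x Ix <-] := f3 _ Jy.
by have [] : [set x | I x /\ M (f x)] x by rewrite NE.
Qed.

(** Right multiplication by [c] is a module map, so its kernel in the ideal
    generated by [a] is a left ideal, and it does not contain [a]. *)
Lemma minimal_mulr_injective a c b : minimal_left_ideal (left_multiples a) ->
  left_multiples a a -> a ** c <> 0 ->
  left_multiples a b -> b ** c = 0 -> b = 0.
Proof.
move=> [al a0 amin] aa ac ab bc.
have Nl : left_ideal [set x | left_multiples a x /\ x ** c = 0].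
  have [A0 AB AM] := al.
  split=> [|x y [Ix xc] [Iy yc]|d x [Ix xc]] /=.
  - by rewrite numul0r.
  - by rewrite numulBl xc yc subr0; split=> //; exact: AB.
  - by rewrite -numulA xc numulr0; split=> //; exact: AM.
have [|NE|NE] := amin _ Nl; first by move=> x [].
  by have : [set x | left_multiples a x /\ x ** c = 0] b by []; rewrite NE.
by have : left_multiples a a by []; rewrite -NE => -[].
Qed.

Lemma minimal_mulr_iso a c : minimal_left_ideal (left_multiples a) ->
  left_multiples a a -> a ** c <> 0 ->
  left_isomorphic (left_multiples a) (left_multiples (a ** c)).
Proof.
move=> amin aa ac; have [[A0 AB AM] _ _] := amin.
exists (fun x => x ** c); split.
- split=> [_ [b _ <-]|x y|_ [b _ <-]].
  + by exists b => //; rewrite numulA.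
  + rewrite !inE => ax ay xy; apply/eqP; rewrite -subr_eq0; apply/eqP.
    apply: (minimal_mulr_injective amin aa ac); first exact: AB.
    by rewrite numulBl xy subrr.
  + by exists (b ** a); [exists b|rewrite numulA].
- by move=> x y _ _; rewrite numulDl.
- by move=> b x _; rewrite numulA.
Qed.

End NonUnital.

(** * Path and ghost elements of the Kumjian-Pask algebra *)

Section KPElements.
Variables (k : nat) (L : kgraph k) (K : fieldType).
Implicit Types (l m : L) (v w : vertex L) (a b : KP L K).
Local Notation p_ := (@KPp k L K).

(** The generators, extended to paths of degree 0, which act as vertices. *)
Definition KS l : KP L K :=
  if (insub l : option (nzpath L)) is Some l' then KPs K l' else p_ (rng l).
Definition KG l : KP L K :=
  if (insub l : option (nzpath L)) is Some l' then KPg K l' else p_ (rng l).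

Lemma KS_nz (l : nzpath L) : KS (val l) = KPs K l.
Proof. by rewrite /KS valK. Qed.

Lemma KG_nz (l : nzpath L) : KG (val l) = KPg K l.
Proof. by rewrite /KG valK. Qed.

Lemma KS_idp v : KS (idp v) = p_ v.
Proof. by rewrite /KS insubF ?rng_idp// deg_idp eqxx. Qed.

Lemma KG_idp v : KG (idp v) = p_ v.
Proof. by rewrite /KG insubF ?rng_idp// deg_idp eqxx. Qed.

Variant kpath_spec : L -> Type :=
  | PathVertex v : kpath_spec (idp v)
  | PathNonzero (l : nzpath L) : kpath_spec (val l).

Lemma kpathP l : kpath_spec l.
Proof.
have [l0|l0] := eqVneq (deg l) 0.
  by rewrite (deg0_idp l0); exact: PathVertex.
exact: (@PathNonzero (Sub l l0)).
Qed.

Lemma KPpp v : p_ v ** p_ v = p_ v.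
Proof. by rewrite KP_kp1 eqxx. Qed.

Lemma KPpKS l : p_ (rng l) ** KS l = KS l.
Proof.
by case: (kpathP l) => [v|{}l]; rewrite ?KS_idp ?rng_idp ?KPpp// KS_nz KP_kp2_ps.
Qed.

Lemma KSKPp l : KS l ** p_ (src l) = KS l.
Proof.
by case: (kpathP l) => [v|{}l]; rewrite ?KS_idp ?src_idp ?KPpp// KS_nz KP_kp2_sp.
Qed.

Lemma KPpKG l : p_ (src l) ** KG l = KG l.
Proof.
by case: (kpathP l) => [v|{}l]; rewrite ?KG_idp ?src_idp ?KPpp// KG_nz KP_kp2_pg.
Qed.

Lemma KGKPp l : KG l ** p_ (rng l) = KG l.
Proof.
by case: (kpathP l) => [v|{}l]; rewrite ?KG_idp ?rng_idp ?KPpp// KG_nz KP_kp2_gp.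
Qed.

Lemma Nk_addr_eq0 (m n : Nk k) : m + n = 0 -> m = 0.
Proof.
move=> /ffunP mn; apply/ffunP => i; have := mn i; rewrite NkD !ffunE => /eqP.
by rewrite addn_eq0 => /andP[/eqP].
Qed.

Lemma nz_comp (l m : nzpath L) : src (val l) = rng (val m) ->
  deg (kcomp (val l) (val m)) != 0.
Proof.
move=> lm; rewrite deg_comp//; apply/eqP => /Nk_addr_eq0 /eqP.
by apply/negP; exact: (valP l).
Qed.

Lemma KS_comp l m : src l = rng m -> KS l ** KS m = KS (kcomp l m).
Proof.
case: (kpathP l) => [v|{}l]; case: (kpathP m) => [w|{}m] lm.
- move: lm; rewrite src_idp rng_idp => ->.
  by rewrite -{3}(rng_idp w) kcomp_idl KS_idp KPpp.
- by rewrite src_idp in lm; rewrite lm kcomp_idl KS_idp KPpKS.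
- by rewrite rng_idp in lm; rewrite -lm kcomp_idr KS_idp KSKPp.
rewrite !KS_nz (KP_kp2_s K (lm := Sub (kcomp (val l) (val m)) (nz_comp lm)) lm)//.
by rewrite -KS_nz.
Qed.

Lemma KG_comp l m : src l = rng m -> KG m ** KG l = KG (kcomp l m).
Proof.
case: (kpathP l) => [v|{}l]; case: (kpathP m) => [w|{}m] lm.
- move: lm; rewrite src_idp rng_idp => ->.
  by rewrite -{3}(rng_idp w) kcomp_idl KG_idp KPpp.
- by rewrite src_idp in lm; rewrite lm kcomp_idl KG_idp KGKPp.
- by rewrite rng_idp in lm; rewrite -lm kcomp_idr KG_idp KPpKG.
rewrite !KG_nz (KP_kp2_g K (lm := Sub (kcomp (val l) (val m)) (nz_comp lm)) lm)//.
by rewrite -KG_nz.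
Qed.

Lemma KS_comp0 l m : src l <> rng m -> KS l ** KS m = 0.
Proof.
move=> /eqP/negPf lm; rewrite -KSKPp -[KS m]KPpKS numulA -(numulA (KS l)).
by rewrite KP_kp1 lm numulr0 numul0r.
Qed.

Lemma KGKS l m : deg l = deg m ->
  KG l ** KS m = if l == m then p_ (src l) else 0.
Proof.
case: (kpathP l) => [v|{}l]; case: (kpathP m) => [w|{}m]; rewrite ?deg_idp.
- by rewrite KG_idp KS_idp KP_kp1 (inj_eq (@idp_inj _ _)) src_idp.
- by move=> m0; have := valP m; rewrite -m0 eqxx.
- by move=> m0; have := valP l; rewrite m0 eqxx.
by move=> lm; rewrite KG_nz KS_nz KP_kp3// -(inj_eq val_inj).
Qed.

Lemma KP_kp4_seq v (n : Nk k) : finite_set (paths_from v n) ->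
  exists s : seq L, [/\ uniq s, forall l, l \in s <-> paths_from v n l
    & p_ v = \sum_(l <- s) KS l ** KG l].
Proof.
move=> fin; have [->|/eqP n0] := eqVneq n 0.
  exists [:: idp v]; split=> //; last by rewrite big_seq1 KS_idp KG_idp KPpp.
  move=> l; rewrite inE; split=> [/eqP ->|[<- /deg0_idp {1}->]//].
  by split; rewrite ?rng_idp ?deg_idp.
have fin' : finite_set [set l : nzpath L | paths_from v n (val l)].
  by apply: (@finite_preimage _ _ _ val) => // l m _ _; apply: val_inj.
have := KP_kp4 K n0 fin; rewrite fsbig_finite//=.
set s := (X in \sum_(l <- X) _) => E.
exists (map val s); split.
- by rewrite map_inj_uniq; [exact: fset_uniq|exact: val_inj].
- move=> l; split=> [/mapP[m + ->]|lP]; first by rewrite /s in_fset_set// inE.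
  have nz : deg l != 0 by case: lP => _ ->; exact/eqP.
  by apply/mapP; exists (Sub l nz) => //; rewrite /s in_fset_set// inE.
- by rewrite E big_map; apply: eq_bigr => l _; rewrite KS_nz KG_nz.
Qed.

(** The algebra is a quotient of formal expressions, on which one can argue by
    structural induction. *)
Lemma KP_induction (P : KP L K -> Prop) :
  (forall v, P (p_ v)) -> (forall l, P (KS l)) -> (forall l, P (KG l)) ->
  (forall a b, P a -> P b -> P (a + b)) -> (forall c a, P a -> P (c *: a)) ->
  (forall a b, P a -> P b -> P (a ** b)) -> P 0 ->
  forall a, P a.
Proof.
move=> Pp Ps Pg PD PZ PM P0 a; rewrite -[a]reprK.
elim: (repr a) => [v|l|l||t IH|t IHt u IHu|c t IH|t IHt u IHu].
- exact: Pp.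
- by have := Ps (val l); rewrite KS_nz.
- by have := Pg (val l); rewrite KG_nz.
- exact: P0.
- by rewrite KP_piN -scaleN1r; exact: PZ.
- by rewrite KP_piD; exact: PD.
- by rewrite KP_piZ; exact: PZ.
- by rewrite KP_piM; exact: PM.
Qed.

End KPElements.

(** * The action of the Kumjian-Pask algebra and combinations of paths *)

Section Action.
Variables (k : nat) (L : kgraph k) (K : fieldType).
Implicit Types (l m : L) (v w : vertex L) (a b : KP L K) (x y z : ipath L).
Implicit Types (f g h : path_fun L K).
Local Notation p_ := (@KPp k L K).
Local Notation KS := (@KS k L K).
Local Notation KG := (@KG k L K).

Definition act a f : path_fun L K := KPhom (rep_family L K) a f.

Lemma act_M a b f : act (a ** b) f = act a (act b f).
Proof. by rewrite /act KPhomM. Qed.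

Lemma act_D a b f q : act (a + b) f q = act a f q + act b f q.
Proof. by rewrite /act; have [-> _ _] := KPhom_hom (rep_family L K). Qed.

Lemma act_Z c a f q : act (c *: a) f q = c * act a f q.
Proof. by rewrite /act; have [_ -> _] := KPhom_hom (rep_family L K). Qed.

Lemma act_0 f q : act 0 f q = 0.
Proof. by rewrite -(scale0r (0 : KP L K)) act_Z mul0r. Qed.

Lemma act_B a b f q : act (a - b) f q = act a f q - act b f q.
Proof. by rewrite act_D -scaleN1r act_Z mulN1r. Qed.

Lemma act_p v f : act (p_ v) f = vertex_fun v f.
Proof. by rewrite /act /KPp KPhomE. Qed.

Lemma path_act_idp v f : path_act (idp v) f = vertex_fun v f.
Proof.
apply/funext => -[z n]; rewrite path_actE vertex_funE deg_idp ip0 ishift0.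
by rewrite (inj_eq (@idp_inj _ _)) zdeg0 subr0.
Qed.

Lemma ghost_act_idp v f : ghost_act (idp v) f = vertex_fun v f.
Proof.
apply/funext => -[z n]; rewrite ghost_actE vertex_funE deg_idp src_idp.
by rewrite zdeg0 addr0; case: eqP => // <-; rewrite icons_idp.
Qed.

Lemma act_KS l f : act (KS l) f = path_act l f.
Proof.
case: (kpathP l) => [v|{}l]; first by rewrite KS_idp act_p path_act_idp.
by rewrite KS_nz /act /KPs KPhomE.
Qed.

Lemma act_KG l f : act (KG l) f = ghost_act l f.
Proof.
case: (kpathP l) => [v|{}l]; first by rewrite KG_idp act_p ghost_act_idp.
by rewrite KG_nz /act /KPg KPhomE.
Qed.

Definition path_sum (s : seq L) (c : L -> K) : KP L K :=
  \sum_(l <- s) c l *: KS l.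

Lemma act_path_sum s c f q :
  act (path_sum s c) f q = \sum_(l <- s) c l * path_act l f q.
Proof.
rewrite /path_sum; elim: s => [|l s IH]; first by rewrite !big_nil act_0.
by rewrite !big_cons act_D act_Z act_KS IH.
Qed.

Definition deg_delta : path_fun L K := fun q => if q.2 == 0 then 1 else 0.

(** Paths whose degree differs from that of [l0] are excluded by [h], and among the
    paths of the same degree only [l0] is an initial segment of [z]. *)
Lemma path_sum_coef (s : seq L) (c : L -> K) l0 (h : Zk k -> K) z :
  uniq s -> l0 \in s -> z (deg l0) = l0 -> h 0 = 1 ->
  (forall l, l \in s -> h (zdeg (deg l0) - zdeg (deg l)) != 0 -> deg l = deg l0) ->
  act (path_sum s c) (fun q => h q.2) (z, zdeg (deg l0)) = c l0.
Proof.
move=> us sl0 zl0 h0 hs; rewrite act_path_sum (bigD1_seq l0)//= path_actE.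
rewrite zl0 eqxx /= subrr h0 mulr1 big_seq_cond big1 ?addr0// => l /andP[sl ll0].
rewrite path_actE; case: eqP => [zl|]; rewrite ?mulr0//=.
have [->|/(hs _ sl) E] := eqVneq (h (zdeg (deg l0) - zdeg (deg l))) 0.
  by rewrite mulr0.
by rewrite E zl0 in zl; rewrite zl eqxx in ll0.
Qed.

Lemma path_sum_delta (s : seq L) (c : L -> K) l0 z :
  uniq s -> l0 \in s -> z (deg l0) = l0 ->
  act (path_sum s c) deg_delta (z, zdeg (deg l0)) = c l0.
Proof.
move=> us sl0 zl0.
apply: (@path_sum_coef s c l0 (fun n => if n == 0 then 1 else 0)) => //.
  by rewrite eqxx.
move=> l sl; case: ifP => [|_]; last by rewrite eqxx.
by rewrite subr_eq0 => /eqP E _; apply/esym/zdeg_inj.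
Qed.

Hypothesis hL : row_finite_no_sources L.

Lemma path_extends l : exists2 z, src l = irng z & icons l z (deg l) = l.
Proof.
have [z zl] := ipath_exists hL (src l).
by exists z => //; rewrite icons_deg_id.
Qed.

Lemma path_sum_neq0 (s : seq L) (c : L -> K) l0 :
  uniq s -> l0 \in s -> c l0 != 0 -> path_sum s c <> 0.
Proof.
move=> us sl0 cl0 E; have [z lz zl] := path_extends l0.
by have := path_sum_delta c us sl0 zl; rewrite E act_0 => /esym/eqP; apply/negP.
Qed.

(** ** Spans of paths *)

Definition path_span (P : L -> Prop) a := exists2 t : seq (K * L),
  (forall q, q \in t -> P q.2) & a = \sum_(q <- t) q.1 *: KS q.2.

Lemma path_span_sub (P Q : L -> Prop) a : (forall l, P l -> Q l) ->
  path_span P a -> path_span Q a.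
Proof. by move=> PQ [t tP ->]; exists t => // q /tP /PQ. Qed.

Lemma path_span0 P : path_span P 0.
Proof. by exists [::]; rewrite ?big_nil. Qed.

Lemma path_span1 (P : L -> Prop) l : P l -> path_span P (KS l).
Proof.
move=> Pl; exists [:: (1, l)]; last by rewrite big_seq1 scale1r.
by move=> q; rewrite inE => /eqP ->.
Qed.

Lemma path_spanD P a b : path_span P a -> path_span P b -> path_span P (a + b).
Proof.
move=> [t tP ->] [u uP ->]; exists (t ++ u); last by rewrite big_cat.
by move=> q; rewrite mem_cat => /orP[/tP|/uP].
Qed.

Lemma path_spanZ P c a : path_span P a -> path_span P (c *: a).
Proof.
move=> [t tP ->]; exists [seq (c * q.1, q.2) | q <- t].
  by move=> q /mapP[r /tP ? ->].
by rewrite big_map scaler_sumr; apply: eq_bigr => q _; rewrite scalerA.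
Qed.

Lemma path_span_mul (P Q : L -> Prop) a b :
  (forall l, P l -> path_span Q (b ** KS l)) ->
  path_span P a -> path_span Q (b ** a).
Proof.
move=> bQ [t tP ->]; elim: t tP => [|q t IH] tP.
  by rewrite big_nil numulr0; exact: path_span0.
rewrite big_cons numulDr -nuscaleAr; apply: path_spanD.
  by apply/path_spanZ/bQ/tP; rewrite inE eqxx.
by apply: IH => r rt; apply: tP; rewrite inE rt orbT.
Qed.

(** Equal paths are merged by adding their coefficients. *)
Lemma path_span_sum P a : path_span P a -> exists (s : seq L) (c : L -> K),
  [/\ uniq s, forall l, l \in s -> P l & a = path_sum s c].
Proof.
move=> [t tP ->]; pose s := undup [seq q.2 | q <- t].
exists s, (fun l => \sum_(q <- t | q.2 == l) q.1); split.
- exact: undup_uniq.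
- by move=> l; rewrite mem_undup => /mapP[q /tP ? ->].
transitivity (\sum_(q <- t) \sum_(l <- s) if q.2 == l then q.1 *: KS l else 0).
  rewrite [LHS]big_seq [RHS]big_seq; apply: eq_bigr => q qt.
  rewrite (bigD1_seq q.2) ?undup_uniq//=; last by rewrite mem_undup map_f.
  by rewrite eqxx big1 ?addr0// => l; rewrite eq_sym => /negPf ->.
rewrite exchange_big; apply: eq_bigr => l _ /=.
by rewrite scaler_suml [RHS]big_mkcond.
Qed.

(** Only finitely many ghosts occur in [a]: multiplying by a long path on the
    right cancels them all.  The bound on the loss of degree makes the property
    stable under products. *)
Lemma mul_long_path a : exists n0 : Nk k, forall m, leNk n0 (deg m) ->
  path_span (fun l => src l = src m /\ leNk (deg m) (deg l + n0)) (a ** KS m).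
Proof.
elim/KP_induction: a => [v|l|l|a b [na aP] [nb bP]|c a [na aP]|a b [na aP] [nb bP]|].
- exists 0 => m _; rewrite -KS_idp; have [vm|vm] := pselect (src (idp v) = rng m).
    rewrite src_idp in vm; rewrite KS_comp ?src_idp// vm kcomp_idl.
    by apply: path_span1; rewrite addr0; split=> //; exact: leNk_refl.
  by rewrite KS_comp0//; exact: path_span0.
- exists 0 => m _; have [lm|lm] := pselect (src l = rng m).
    rewrite KS_comp//; apply: path_span1.
    by rewrite src_comp// deg_comp// addr0 leNk_addl.
  by rewrite KS_comp0//; exact: path_span0.
- exists (deg l) => m /[dup] ln /cutP[E1 E2 E3].
  rewrite [in KS m]E3 -KS_comp// numulA KGKS//; case: eqP => lE.
    rewrite (congr1 src lE) E1 KPpKS; apply: path_span1; split.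
      by rewrite [in RHS]E3 src_comp.
    by rewrite [in X in leNk X _]E3 deg_comp// E2 addrC leNk_refl.
  by rewrite numul0r; exact: path_span0.
- exists (na + nb) => m mn; rewrite numulDl; apply: path_spanD.
    apply: path_span_sub (aP m _); last by apply: leNk_trans mn; exact: leNk_addr.
    move=> l [-> ml]; split=> //; apply: leNk_trans ml _.
    by rewrite addrA leNk_addr.
  apply: path_span_sub (bP m _); last by apply: leNk_trans mn; exact: leNk_addl.
  move=> l [-> ml]; split=> //; apply: leNk_trans ml _.
  by rewrite [na + nb]addrC addrA leNk_addr.
- by exists na => m mn; rewrite -nuscaleAl; apply/path_spanZ/aP.
- exists (na + nb) => m mn; rewrite -numulA.
  have mb : leNk nb (deg m) by apply: leNk_trans mn; exact: leNk_addl.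
  apply: path_span_mul (bP m mb) => l [ml dl].
  have al : leNk na (deg l).
    apply: (@leNk_cancel _ nb); rewrite [nb + na]addrC [nb + _]addrC.
    exact: leNk_trans dl.
  apply: path_span_sub (aP l al) => l' [l'l dl']; split; first by rewrite l'l.
  apply: leNk_trans dl _; rewrite addrA; apply: leNk_add => //; exact: leNk_refl.
- by exists 0 => m _; rewrite numul0r; exact: path_span0.
Qed.

(** ** Local units *)

Definition vertex_sum (s : seq (vertex L)) : KP L K := \sum_(v <- s) p_ v.

Lemma vertex_sum_mull (s : seq (vertex L)) v a : uniq s -> v \in s ->
  p_ v ** a = a -> vertex_sum s ** a = a.
Proof.
move=> us sv va; rewrite /vertex_sum numul_suml (bigD1_seq v)//= va big1 ?addr0//.
by move=> w wv; rewrite -va numulA KP_kp1 (negPf wv) numul0r.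
Qed.

Lemma vertex_sum_mulr (s : seq (vertex L)) v a : uniq s -> v \in s ->
  a ** p_ v = a -> a ** vertex_sum s = a.
Proof.
move=> us sv va; rewrite /vertex_sum numul_sumr (bigD1_seq v)//= va big1 ?addr0//.
by move=> w wv; rewrite -va -numulA KP_kp1 eq_sym (negPf wv) numulr0.
Qed.

(** The algebra has no unit in general, but [a] involves finitely many vertices. *)
Lemma local_units a : exists s : seq (vertex L), forall t, uniq t -> {subset s <= t} ->
  vertex_sum t ** a = a /\ a ** vertex_sum t = a.
Proof.
elim/KP_induction: a => [v|l|l|a b [s aP] [u bP]|c a [s aP]|a b [s aP] [u bP]|].
- exists [:: v] => t ut vt; have tv : v \in t by apply: vt; rewrite inE.
  by rewrite (vertex_sum_mull ut tv) ?(vertex_sum_mulr ut tv) ?KPpp.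
- exists [:: rng l; src l] => t ut lt.
  rewrite (@vertex_sum_mull _ (rng l)) ?KPpKS// ?lt ?inE ?eqxx//.
  by rewrite (@vertex_sum_mulr _ (src l)) ?KSKPp// ?lt ?inE ?eqxx ?orbT.
- exists [:: rng l; src l] => t ut lt.
  rewrite (@vertex_sum_mull _ (src l)) ?KPpKG// ?lt ?inE ?eqxx ?orbT//.
  by rewrite (@vertex_sum_mulr _ (rng l)) ?KGKPp// ?lt ?inE ?eqxx.
- exists (s ++ u) => t ut st; have [|a1 a2] := aP t ut.
    by move=> v vs; apply: st; rewrite mem_cat vs.
  have [|b1 b2] := bP t ut; first by move=> v vs; apply: st; rewrite mem_cat vs orbT.
  by rewrite numulDr numulDl a1 a2 b1 b2.
- by exists s => t ut st; rewrite -nuscaleAr -nuscaleAl; have [-> ->] := aP t ut st.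
- exists (s ++ u) => t ut st; have [|a1 a2] := aP t ut.
    by move=> v vs; apply: st; rewrite mem_cat vs.
  have [|b1 b2] := bP t ut; first by move=> v vs; apply: st; rewrite mem_cat vs orbT.
  by rewrite numulA a1 -numulA b2.
- by exists [::] => t _ _; rewrite numul0r numulr0.
Qed.

Lemma mem_left_multiples a : left_multiples a a.
Proof.
have [s sP] := local_units a; have [||a1 _] := sP (undup s).
- exact: undup_uniq.
- by move=> v; rewrite mem_undup.
by exists (vertex_sum (undup s)).
Qed.

(** By (KP4) the vertex is the sum of the m m* over the paths m of degree [n]. *)
Lemma mul_vertex_eq0 a v (n : Nk k) :
  (forall m, paths_from v n m -> a ** KS m = 0) -> a ** p_ v = 0.
Proof.
move=> a0; have [_ /(KP_kp4_seq K)[t [_ tP ->]]] := hL v n.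
rewrite numul_sumr big_seq big1// => m /tP mv.
by rewrite numulA a0// numul0r.
Qed.

Lemma mul_paths_eq0 a (n : Nk k) : (forall m, deg m = n -> a ** KS m = 0) -> a = 0.
Proof.
move=> a0; have [s sP] := local_units a; have [||_ <-] := sP (undup s).
- exact: undup_uniq.
- by move=> v; rewrite mem_undup.
rewrite /vertex_sum numul_sumr big1// => v _.
by apply: (@mul_vertex_eq0 _ _ n) => m [_]; exact: a0.
Qed.

(** The form to which every nonzero element is reduced: its ghosts are cancelled
    and what remains is visibly nonzero. *)
Lemma mul_path_reduction a : a <> 0 -> exists m (s : seq L) (c : L -> K) l0,
  [/\ a ** KS m = path_sum s c, uniq s, forall l, l \in s -> src l = src m,
      l0 \in s & c l0 != 0].
Proof.
move=> a0; have [n0 aP] := mul_long_path a.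
have [m mn am] : exists2 m, deg m = n0 & a ** KS m <> 0.
  apply: contrapT => nm; apply: a0; apply: (@mul_paths_eq0 _ n0) => m mn.
  by apply: contrapT => am; apply: nm; exists m.
have [|s [c [us sP E]]] := path_span_sum (aP m _); first by rewrite mn leNk_refl.
have [l0 sl0 cl0] : exists2 l0, l0 \in s & c l0 != 0.
  apply: contrapT => nl; apply: am; rewrite E /path_sum big_seq big1// => l sl.
  have [->|cl] := eqVneq (c l) 0; first by rewrite scale0r.
  by case: nl; exists l.
by exists m, s, c, l0; split=> // l /sP[].
Qed.

End Action.

(** * Minimal left ideals *)

Section Minimality.
Variables (k : nat) (L : kgraph k) (K : fieldType).
Hypothesis hL : row_finite_no_sources L.
Implicit Types (l m : L) (v w : vertex L) (a b : KP L K) (x y z : ipath L).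
Implicit Types (s : seq L) (c : L -> K).
Local Notation p_ := (@KPp k L K).
Local Notation KS := (@KS k L K).
Local Notation KG := (@KG k L K).

(** Right composition with [m] is injective on paths, so the coefficients are
    carried over; they are recovered by cutting off the last [deg m]. *)
Lemma path_sum_KS s c m : (forall l, l \in s -> src l = rng m) ->
  exists c', path_sum s c ** KS m = path_sum [seq kcomp l m | l <- s] c' /\
    forall l, l \in s -> c' (kcomp l m) = c l.
Proof.
move=> sm; exists (fun l => c (pre (subNk (deg l) (deg m)) l)).
have E l : l \in s -> pre (subNk (deg (kcomp l m)) (deg m)) (kcomp l m) = l.
  move=> /sm lm; rewrite pre_comp// deg_comp//.
  by apply/ffunP => i; rewrite ffunE NkD addnK.
split; last by move=> l /E ->.
rewrite /path_sum big_map numul_suml big_seq [RHS]big_seq.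
by apply: eq_bigr => l sl; rewrite E// -nuscaleAl KS_comp// sm.
Qed.

Lemma kcomp_uniq s m : (forall l, l \in s -> src l = rng m) -> uniq s ->
  uniq [seq kcomp l m | l <- s].
Proof.
move=> sm us; rewrite map_inj_in_uniq// => l l' /sm lm /sm lm' E.
have /(congr1 deg) := E; rewrite !deg_comp// ![_ + deg m]addrC => /Nk_addI dl.
by have [] := kcomp_inj lm lm' dl E.
Qed.

Lemma path_sum_KS_neq0 s c m l0 : (forall l, l \in s -> src l = rng m) ->
  uniq s -> l0 \in s -> c l0 != 0 -> path_sum s c ** KS m <> 0.
Proof.
move=> sm us sl0 cl0; have [c' [-> c'E]] := path_sum_KS c sm.
apply: (path_sum_neq0 hL (l0 := kcomp l0 m)).
- exact: kcomp_uniq.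
- exact: map_f.
- by rewrite c'E.
Qed.

Lemma KG_ip_KS x (n p : Nk k) m : deg m = n ->
  KG (x (n + p)) ** KS m = if x n == m then KG (ishift n x p) else 0.
Proof.
move=> mn; rewrite ipD -KG_comp -?src_ip_rng// -numulA KGKS ?ip_deg//.
case: eqP => _; last by rewrite numulr0.
by rewrite (src_ip_rng x n p) KGKPp.
Qed.

Lemma Zk_mulrzE (u : Zk k) (j : int) i : (u *~ j) i = u i * j.
Proof. by rewrite ffunMzE mulrzz. Qed.

Section MinimalPathSum.
Variables (s : seq L) (c : L -> K) (l0 : L).
Hypothesis s_uniq : uniq s.
Hypothesis s_src : forall l, l \in s -> src l = src l0.
Hypothesis s_l0 : l0 \in s.
Hypothesis c_l0 : c l0 != 0.
Local Notation a := (path_sum s c).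
Hypothesis a_min : minimal_left_ideal (left_multiples a).

(** The path on the right is the only [y] for which [l] followed by [y] could be
    [l0] followed by [z].  If [y] were none of these, some initial segment of [y]
    would kill a nonzero element of the ideal without killing its generator. *)
Lemma minimal_finitely_many_ipaths z : irng z = src l0 ->
  forall y, irng y = src l0 ->
    exists2 l, l \in s & y = ishift (deg l) (icons l0 z).
Proof.
move=> zl0 y yl0; apply: contrapT => ny; set x := icons l0 z.
have xl0 : x (deg l0) = l0 by rewrite icons_deg_id.
have /choice[N NP] : forall l, exists n, l \in s -> y n <> ishift (deg l) x n.
  move=> l; have [sl|] := boolP (l \in s); last by exists 0.
  have [|n yn] := @ipath_neqP _ _ y (ishift (deg l) x); last by exists n.
  by move=> yE; apply: ny; exists l.
(* Long enough for [y n] to differ from all the candidates at once, and for the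
   ghost of [t] to absorb every [l] followed by [y n]. *)
pose n := \sum_(l <- s) N l; pose d := \sum_(l <- s) deg l.
pose t := x (d + n); pose b := KG t ** a.
have sr l : l \in s -> src l = rng (y n) by move=> /s_src ->; rewrite rng_ip.
have b0 : b ** KS (y n) = 0.
  rewrite /b -numulA /path_sum numul_suml numul_sumr big_seq big1// => l sl.
  rewrite -nuscaleAl -nuscaleAr KS_comp ?sr//.
  have /leNkP[e de] : leNk (deg l) d by exact: leNk_sum.
  rewrite /t de [deg l + e]addrC -addrA [e + _]addrC KG_ip_KS.
    case: eqP => [|_]; last by rewrite scaler0.
    rewrite ipD => /kcomp_inj[].
    + by rewrite -src_ip_rng.
    + exact: sr.
    + by rewrite ip_deg.
    by move=> _ /esym /(ipath_neq_above (@leNk_sum _ _ s N l sl) (NP _ sl)).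
  by rewrite deg_comp ?sr// ip_deg.
have nb0 : b <> 0.
  move=> bE; have := path_sum_delta c s_uniq s_l0 xl0.
  have := act_0 (@deg_delta k L K) (ishift (d + n) x, zdeg (deg l0) - zdeg (d + n)).
  rewrite -bE act_M act_KG ghost_actE /t src_ip eqxx ip_deg icons_ishift subrK => ->.
  by move/esym/eqP; apply/negP.
apply: nb0; apply: (minimal_mulr_injective a_min (mem_left_multiples a) (c := KS (y n))) => //.
- exact: (path_sum_KS_neq0 sr s_uniq s_l0).
- by exists (KG t).
Qed.

(** If [p] and [q] differ, the operator [f] below compares a function at the path
    [l0] followed by [x] with its translate by a multiple of the period.  Then
    [f ** a] generates the same ideal as [a], whereas it kills the functions
    invariant under that translation and [a] does not. *)
Lemma minimal_aperiodic x (p q : Nk k) : irng x = src l0 ->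
  (forall y, irng y = src l0 -> y = x) -> ishift p x = ishift q x -> p = q.
Proof.
move=> xl0 xu pq; apply: contrapT => npq.
have [i pqi] : exists i, p i <> q i.
  apply: contrapT => npqi; apply: npq; apply/ffunP => i; apply: contrapT => pqi.
  by apply: npqi; exists i.
pose z := icons l0 x; pose d := deg l0.
have zl0 : z d = l0 by rewrite icons_deg_id.
have zu y : y d = l0 -> y = z.
  move=> yl0; rewrite -(icons_ishift y d) yl0 (xu (ishift d y))//.
  by rewrite -src_ip yl0.
(* Large enough for no nonzero multiple of N (p - q) to be a difference of degrees
   of paths in [s]. *)
pose N := (\sum_(l <- s) (d i + deg l i)).+1.
pose P := p *+ N; pose Q := q *+ N; pose t := zdeg P - zdeg Q.
have PQ : ishift P x = ishift Q x.
  rewrite /P /Q; elim: {P Q t}N => [//|M IH].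
  by rewrite mulrSr -ishiftD IH ishiftD addrC mulrS -!ishiftD pq.
have t_sep l (j : int) : l \in s -> zdeg d - zdeg (deg l) = t *~ j ->
    j = 0 /\ deg l = d.
  move=> sl E; have j0 : j = 0.
    have lN : (d i + deg l i < N)%N by rewrite ltnS (big_rem l)//= leq_addr.
    have /ffunP/(_ i) := E; rewrite /t /P /Q Zk_mulrzE !ffunE !Nk_mulrnE => Ei.
    apply: contrapT => j0; have pqj : (p i)%:Z * j <> (q i)%:Z * j.
      by move=> /(mulIf (introN eqP j0)) [].
    move: lN Ei pqj; move: (d i) (deg l i) (p i) (q i) => d1 d2 p1 q1. nia.
  by split=> //; move: E; rewrite j0 mulr0z => /eqP; rewrite subr_eq0 => /eqP/zdeg_inj.
(* The projection onto functions supported on [z], minus translation by [t]. *)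
pose f := KS l0 ** KG l0 - KS (z (d + P)) ** KG (z (d + Q)).
have fE (h : Zk k -> K) y n : act (f ** a) (fun r => h r.2) (y, n) =
    if y d == l0 then act a (fun r => h r.2 - h (r.2 - t)) (z, n) else 0.
  rewrite act_M act_B !act_M !act_KS !act_KG path_ghost_act path_actE ip_deg.
  rewrite -/d; have [/zu ->|yd] := eqVneq (y d) l0; last first.
    case: eqP => [E|_]; last by rewrite subrr.
    by rewrite -(ip_pre y d P) E ip_pre zl0 eqxx in yd.
  have zPQ : ishift (d + P) z = ishift (d + Q) z.
    by rewrite -!ishiftD ishift_icons// PQ ishiftD.
  rewrite eqxx ghost_actE zPQ -src_ip eqxx ip_deg icons_ishift.
  have -> : n - zdeg (d + P) + zdeg (d + Q) = n - t.
    rewrite /t !zdegD !opprD opprK !addrA.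
    by rewrite [n - zdeg d - _]addrAC subrK.
  rewrite !act_path_sum -sumrB; apply: eq_bigr => l _.
  rewrite !path_actE -mulrBr /=; congr (_ * _); case: eqP => _; last by rewrite subrr.
  by rewrite [n - t - _]addrAC.
have t0 : t <> 0.
  move=> t0; have [] := t_sep l0 1 s_l0; last by [].
  by rewrite t0 subrr mul0rz.
have fa0 : f ** a <> 0.
  move=> fa; pose h (n : Zk k) : K := if n == 0 then 1 else 0.
  have := fE h z (zdeg d); rewrite zl0 eqxx fa act_0.
  rewrite (path_sum_coef c (h := fun n => h n - h (n - t)) s_uniq s_l0 zl0).
  - by move/esym/eqP; apply/negP.
  - rewrite /h eqxx sub0r oppr_eq0; case: eqP => [/t0//|_]; by rewrite subr0.
  - move=> l sl; rewrite /h; have [E _|nE] := eqVneq (zdeg d - zdeg (deg l)) 0.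
      by have [] := t_sep l 0 sl; rewrite ?E ?mulr0z.
    have [E _|nE'] := eqVneq (zdeg d - zdeg (deg l) - t) 0; last by rewrite subrr eqxx.
    have [] := t_sep l 1 sl; last by [].
    by rewrite mulr1z; apply/eqP; rewrite -subr_eq0 E.
have fal : left_multiples (f ** a) = left_multiples a.
  apply: (minimal_left_ideal_multiples a_min); first by exists f.
  by move=> E; apply: fa0; have := mem_left_multiples (f ** a); rewrite E.
have : left_multiples (f ** a) a by rewrite fal; exact: mem_left_multiples.
(* The indicator function of the subgroup generated by [t]: it is invariant under
   translation by [t], and still detects the coefficient of [l0]. *)
move=> [b _ ba]; pose h (n : Zk k) : K := if `[< exists j, n = t *~ j >] then 1 else 0.
have ht n : h (n - t) = h n.
  rewrite /h; congr (if _ then _ else _); apply: asbool_equiv_eq; split=> -[j E].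
    by exists (j + 1); rewrite mulrzDr mulr1z -E subrK.
  by exists (j - 1); rewrite mulrzBr mulr1z E.
have : act a (fun r => h r.2) (z, zdeg d) = c l0.
  apply: path_sum_coef => //.
    by rewrite /h; case: asboolP => // -[]; exists 0; rewrite mulr0z.
  move=> l sl; rewrite /h; case: asboolP => [[j /(t_sep _ _ sl)[]//]|].
  by rewrite eqxx.
rewrite -ba act_M.
have -> : act (f ** a) (fun r => h r.2) = 0.
  apply/funext => -[y n]; rewrite fE; case: ifP => // _.
  rewrite act_path_sum big1// => l _; rewrite path_actE /= ht subrr.
  by case: ifP; rewrite mulr0.
rewrite /act endo0 => /esym/eqP; exact/negP.
Qed.

End MinimalPathSum.

(** ** Line points *)

(** A long initial segment of one of the paths separates it from the others. *)
Lemma finitely_many_isolated w s (Z : L -> ipath L) :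
  (forall y, irng y = w -> exists2 l, l \in s & y = Z l) ->
  exists m x, [/\ rng m = w, irng x = src m & forall y, irng y = src m -> y = x].
Proof.
move=> sZ; have [z zw] := ipath_exists hL w.
have /choice[N NP] : forall l, exists n, z <> Z l -> z n <> Z l n.
  move=> l; have [->|/ipath_neqP[n zn]] := pselect (z = Z l); first by exists 0.
  by exists n.
pose n := \sum_(l <- s) N l.
exists (z n), (ishift n z); split; rewrite ?rng_ip ?src_ip// => y yz.
have zy : src (z n) = irng y by rewrite yz src_ip.
have [|l sl yl] := sZ (icons (z n) y); first by rewrite irng_icons// rng_ip.
rewrite -(ishift_icons zy) ip_deg yl; congr (ishift n _).
apply: contrapT => /nesym /NP zl.
have : z n <> Z l n by apply: ipath_neq_above zl; exact: leNk_sum.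
by apply; rewrite -yl; have := icons_deg_id zy; rewrite ip_deg.
Qed.

Lemma vertex_path_sum v : p_ v = path_sum [:: idp v] (fun=> 1).
Proof. by rewrite /path_sum big_seq1 scale1r KS_idp. Qed.

Lemma vertex_neq0 v : p_ v <> 0.
Proof.
rewrite vertex_path_sum; apply: (path_sum_neq0 hL (l0 := idp v)) => //.
  by rewrite inE.
exact: oner_neq0.
Qed.

(** Only one path of degree [n] starts at the range of [x], as every finite path
    extends to an infinite one; so (KP4) has a single term. *)
Lemma KS_KG_unique x (n : Nk k) : (forall y, irng y = irng x -> y = x) ->
  KS (x n) ** KG (x n) = p_ (irng x).
Proof.
move=> xu; have [_ /(KP_kp4_seq K)[s [us sP ->]]] := hL (irng x) n.
rewrite (bigD1_seq (x n))//=; last by apply/sP; rewrite /paths_from/= rng_ip ip_deg.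
rewrite big_seq_cond big1 ?addr0// => l /andP[/sP[lx ln] /eqP[]].
have [z lz zl] := path_extends hL l.
by rewrite -(xu (icons l z)) ?irng_icons// -ln zl.
Qed.

(** If l x = m x, shifting by [deg l + deg m] gives two shifts of [x] that agree;
    aperiodicity then forces the degrees to be equal. *)
Lemma icons_aperiodic_inj x l m : (forall p q, ishift p x = ishift q x -> p = q) ->
  src l = irng x -> src m = irng x -> icons l x = icons m x -> l = m.
Proof.
move=> xa lx mx E; have lm : deg l = deg m.
  apply: xa; rewrite -{1}(ishift_icons mx) -E ishiftD addrC -ishiftD.
  by rewrite ishift_icons.
by rewrite -(icons_deg_id lx) E lm icons_deg_id.
Qed.

(** The paths [l] in the reduced form of [a] give distinct infinite paths when
    followed by the tail [y] of [x].  Hence the ghost of a long initial segment of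
    one of them kills all the terms but one, which is then inverted by means of
    (KP4) for the unique path. *)
Lemma line_point_generates x a : (forall y, irng y = irng x -> y = x) ->
  (forall p q, ishift p x = ishift q x -> p = q) ->
  a ** p_ (irng x) = a -> a <> 0 -> left_multiples a (p_ (irng x)).
Proof.
move=> xu xa av a0.
have [m [s [c [l0 [aE us sm sl0 cl0]]]]] := mul_path_reduction hL a0.
have mx : rng m = irng x.
  apply: contrapT => /nesym; rewrite -{1}(src_idp (irng x)) => xm.
  have := path_sum_neq0 hL us sl0 cl0; rewrite -aE -av -numulA -KS_idp.
  by rewrite KS_comp0// numulr0.
have xmE : x (deg m) = m.
  have [z mz zm] := path_extends hL m.
  by rewrite -(xu (icons m z)) ?irng_icons.
pose y := ishift (deg m) x.
have my : src m = irng y by rewrite -src_ip xmE.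
have yu z : irng z = irng y -> z = y.
  rewrite -my => /esym mz; rewrite -(ishift_icons mz) (xu (icons m z))//.
  by rewrite irng_icons.
have ya p q : ishift p y = ishift q y -> p = q.
  by rewrite !ishiftD => /xa /Nk_addI.
have sy l : l \in s -> src l = irng y by move=> /sm ->.
have /choice[N NP] : forall l, exists n,
    l \in s -> l != l0 -> icons l y n <> icons l0 y n.
  move=> l; have [/andP[sl ll0]|H] := boolP ((l \in s) && (l != l0)).
    have /ipath_neqP[n yn] : icons l y <> icons l0 y.
      by move=> /(icons_aperiodic_inj ya (sy _ sl) (sy _ sl0)) E; rewrite E eqxx in ll0.
    by exists n.
  by exists 0 => sl ll0; case/negP: H; rewrite sl.
pose n := \sum_(l <- s) N l + \sum_(l <- s) deg l.
pose X := icons l0 y.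
have GS l : l \in s -> exists r,
    KG (X n) ** KS l = if l == l0 then KG (y r) else 0.
  move=> sl; have /leNkP[r nr] : leNk (deg l) n.
    by apply: (@leNk_trans _ (\sum_(l <- s) deg l)); [exact: leNk_sum|exact: leNk_addl].
  exists r; have ly : icons l y n = kcomp l (y r) by rewrite nr iconsD// sy.
  have -> : KS l = KS (icons l y n) ** KG (y r).
    rewrite ly -KS_comp ?rng_ip ?sy// -numulA KS_KG_unique// -(sy _ sl).
    by rewrite KSKPp.
  rewrite numulA KGKS ?ip_deg//; case: eqP => [E|nE].
    case: eqP => [_|/eqP ll0].
      by rewrite E ly src_comp ?KPpKG// rng_ip sy.
    case: (@ipath_neq_above _ _ (N l) n _ _ _ (NP _ sl ll0)) => //.
    by apply: (@leNk_trans _ (\sum_(l <- s) N l)); [exact: leNk_sum|exact: leNk_addr].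
  by case: eqP nE => [->//|_ _]; rewrite numul0r.
have [r GSl0] := GS _ sl0; rewrite eqxx in GSl0.
have GaE : KG (X n) ** (a ** KS m) = c l0 *: KG (y r).
  rewrite aE /path_sum numul_sumr (bigD1_seq l0)//= -nuscaleAr GSl0.
  rewrite big_seq_cond big1 ?addr0// => l /andP[sl ll0].
  have [r' E] := GS _ sl.
  by rewrite -nuscaleAr E (negPf ll0) scaler0.
exists ((c l0)^-1 *: (KS m ** KS (y r) ** KG (X n))) => //.
have -> : a = (a ** KS m) ** KG m.
  by rewrite -numulA -{1 2}xmE KS_KG_unique// av.
rewrite -nuscaleAl numulA -(numulA _ (KG (X n))) GaE.
rewrite -nuscaleAr -nuscaleAl scalerA mulVf// scale1r.
rewrite -(numulA (KS m)) KS_KG_unique// -my KSKPp.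
by rewrite -{1 2}xmE KS_KG_unique.
Qed.

Lemma line_point_minimal v : line_points L v ->
  minimal_left_ideal (left_multiples (p_ v)).
Proof.
move=> /line_pointsP[x [xv xu xa]].
split; first exact: left_multiples_ideal.
  by move=> E; apply: (@vertex_neq0 v); have := mem_left_multiples (p_ v); rewrite E.
move=> J Jl Jv; have [J0|] := pselect (forall a, J a -> a = 0).
  by left; apply/seteqP; split=> // _ ->; case: Jl.
move=> /existsNP[a /not_implyP[Ja a0]]; right; apply/seteqP; split=> //.
have av : a ** p_ v = a by have [b _ <-] := Jv _ Ja; rewrite -numulA KPpp.
have := @line_point_generates x a; rewrite xv => /(_ xu xa av a0) [b _ <-].
by apply: left_ideal_sub_multiples => //; case: Jl => _ _; apply.
Qed.

Lemma minimal_line_point v : minimal_left_ideal (left_multiples (p_ v)) ->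
  line_points L v.
Proof.
rewrite vertex_path_sum => vmin; apply/line_pointsP.
have [z zv] := ipath_exists hL v.
have sv l : l \in [:: idp v] -> src l = src (idp v) by rewrite inE => /eqP ->.
have iv : idp v \in [:: idp v] by rewrite inE.
have zu y : irng y = v -> y = z.
  move=> yv; have := @minimal_finitely_many_ipaths [:: idp v] (fun=> 1) (idp v) isT sv iv
    (oner_neq0 K) vmin z.
  rewrite src_idp => /(_ zv y yv)[l].
  by rewrite inE => /eqP -> ->; rewrite deg_idp ishift0 -zv icons_idp.
exists z; split=> // p q.
apply: (@minimal_aperiodic [:: idp v] (fun=> 1) (idp v) isT iv (oner_neq0 K) vmin).
  by rewrite src_idp.
by rewrite src_idp.
Qed.

(** [a] is multiplied on the right twice: by [m] to cancel the ghosts, then by [r]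
    to arrive at a vertex with a single infinite path. *)
Lemma minimal_iso_line_point a : minimal_left_ideal (left_multiples a) ->
  exists v, line_points L v /\
    left_isomorphic (left_multiples (p_ v)) (left_multiples a).
Proof.
move=> amin; have a0 : a <> 0.
  move=> a0; case: amin => _ + _; apply; rewrite a0.
  by apply/seteqP; split=> [_ [b _ <-]|_ ->]; rewrite ?numulr0//; exists 0; rewrite ?numulr0.
have aa := mem_left_multiples a.
have [m [s [c [l0 [bE us sm sl0 cl0]]]]] := mul_path_reduction hL a0.
have b0 : a ** KS m <> 0 by rewrite bE; exact: path_sum_neq0 sl0 cl0.
have bmin : minimal_left_ideal (left_multiples (a ** KS m)).
  apply: (minimal_left_ideal_iso (minimal_mulr_iso amin aa b0) _ amin).
  exact: left_multiples_ideal.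
have sl l : l \in s -> src l = src l0 by move=> /sm ->; rewrite (sm l0).
have [z zl0] := ipath_exists hL (src l0).
have fin : forall y, irng y = src l0 ->
    exists2 l, l \in s & y = ishift (deg l) (icons l0 z).
  by rewrite bE in bmin; exact: (minimal_finitely_many_ipaths us sl sl0 cl0 bmin zl0).
have [r [x [rl0 xr xu]]] := finitely_many_isolated fin.
have sr l : l \in s -> src l = rng r by move=> /sl ->.
have [c' [eE c'E]] := path_sum_KS c sr; rewrite -bE in eE.
set e := a ** KS m ** KS r in eE.
have e0 : e <> 0 by rewrite /e bE; exact: path_sum_KS_neq0 sl0 cl0.
have emin : minimal_left_ideal (left_multiples e).
  apply: (minimal_left_ideal_iso (minimal_mulr_iso bmin _ e0) _ bmin).
    exact: mem_left_multiples.
  exact: left_multiples_ideal.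
have rline : line_points L (src r).
  apply/line_pointsP; exists x; split=> // p q.
  have E : src (kcomp l0 r) = src r by rewrite src_comp// sr.
  rewrite eE in emin.
  apply: (@minimal_aperiodic [seq kcomp l r | l <- s] c' (kcomp l0 r)) => //.
  - exact: kcomp_uniq.
  - exact: map_f.
  - by rewrite c'E.
  - by rewrite E.
  - by rewrite E.
exists (src r); split=> //.
have <- : left_multiples e = left_multiples (p_ (src r)).
  apply: minimal_left_ideal_multiples.
  - exact: line_point_minimal.
  - by exists e => //; rewrite /e -numulA KSKPp.
  - by case: emin.
apply: left_isomorphic_sym; first exact: left_multiples_ideal.
rewrite /e -numulA; apply: minimal_mulr_iso => //.
by rewrite numulA.
Qed.

End Minimality.

Theorem theorem3p9 (k : nat) (hk : (0 < k)%N) (L : kgraph k)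
    (hL : row_finite_no_sources L) (K : fieldType) :
  (forall v : vertex L,
     minimal_left_ideal (left_multiples (KPp K v)) <-> line_points L v) /\
  (forall a : KP L K,
     minimal_left_ideal (left_multiples a) <->
     exists v : vertex L, line_points L v /\
       left_isomorphic (left_multiples (KPp K v)) (left_multiples a)).
Proof.
split=> [v|a]; split.
- exact: minimal_line_point.
- exact: line_point_minimal.
- exact: minimal_iso_line_point.
move=> [v [vline va]].
apply: (minimal_left_ideal_iso va); first exact: left_multiples_ideal.
exact: line_point_minimal.
Qed.
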